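(* Let $M_n$ be an $n\times n$ symmetric matrix whose entries on and above the diagonal are i.i.d. random variables taking the values $\pm1$ with probability $1/2$ each. Let $W_n=\frac{1}{\sqrt n}M_n$, with eigenvalues $\lambda_1(W_n),\dots,\lambda_n(W_n)$. For any constant $C_1>0$, there is a constant $C_2>0$ such that the following holds. (Bulk case) With probability at least $1-n^{-C_1}$, for any fixed $\epsilon>0$ and any $1\le i\le n$ with $\lambda_i(W_n)\in[-2+\epsilon,2-\epsilon]$, there is a unit eigenvector $u_i(W_n)$ of $\lambda_i(W_n)$ satisfying $$\|u_i(W_n)\|_\infty\le\frac{C_2\log^{1/2}n}{\sqrt n}.$$ (Edge case) With probability at least $1-n^{-C_1}$, for any $\epsilon>0$ and any $1\le i\le n$ with $\lambda_i(W_n)\in[-2-\epsilon,-2+\epsilon]\cup[2-\epsilon,2+\epsilon]$, there is a unit eigenvector $u_i(W_n)$ of $\lambda_i(W_n)$ satisfying $$\|u_i(W_n)\|_\infty\le\frac{C_2\log n}{\sqrt n}.$$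
   Context: $\|u\|_\infty$ is the maximum modulus of the coordinates of $u$; a unit vector is one of Euclidean norm $1$. An eigenvector of $\lambda_i(W_n)$ means an eigenvector of $W_n$ with eigenvalue $\lambda_i(W_n)$. The setting is asymptotic, with $n\to\infty$. *)

(* Defs.v *)
From HB Require Import structures.
From mathcomp Require Export all_boot all_order all_algebra.
From mathcomp Require Export all_classical all_reals all_analysis.

Set Implicit Arguments.
Unset Strict Implicit.
Unset Printing Implicit Defensive.

Import Order.TTheory GRing.Theory Num.Theory.
Import numFieldNormedType.Exports.

Local Open Scope classical_set_scope.
Local Open Scope ring_scope.

(* Mutual independence of the subfamily (X i), i \in D: the product rule holds
   for every finite set of indices in D and all Borel sets. *)
Definition mutually_independent d (T : measurableType d) (R : realType)
    (P : probability T R) (I : finType) (D : {set I})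
    (X : I -> {RV P >-> R}) : Prop :=
  forall (J : {set I}) (B : I -> set R),
    J \subset D -> (forall i, measurable (B i)) ->
    P (\bigcap_(i in [set` J]) (X i @^-1` B i)) =
    (\prod_(i in J) P (X i @^-1` B i))%E.

Definition rademacher d (T : measurableType d) (R : realType)
    (P : probability T R) (X : {RV P >-> R}) : Prop :=
  P (X @^-1` [set 1]) = (2^-1)%:E /\ P (X @^-1` [set -1]) = (2^-1)%:E.

(* The entries x i j form a symmetric array whose entries on and above the
   diagonal are i.i.d. random signs. *)
Definition symmetric_rademacher d (T : measurableType d) (R : realType)
    (P : probability T R) (n : nat) (x : 'I_n -> 'I_n -> {RV P >-> R}) : Prop :=
  [/\ forall (i j : 'I_n) (w : T), x i j w = x j i w,
      forall i j : 'I_n, (i <= j)%N -> rademacher (x i j)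
    & mutually_independent [set p : 'I_n * 'I_n | (p.1 <= p.2)%N]%SET
        (fun p => x p.1 p.2)].

Definition random_matrix d (T : measurableType d) (R : realType)
    (P : probability T R) (n : nat) (x : 'I_n -> 'I_n -> {RV P >-> R})
    (w : T) : 'M[R]_n :=
  \matrix_(i, j) x i j w.

Definition normalized (R : realType) (n : nat) (M : 'M[R]_n) : 'M[R]_n :=
  (Num.sqrt n%:R)^-1 *: M.

(* l lists the eigenvalues of A with multiplicity, in no particular order. *)
Definition eigenvalue_list (R : realType) (n : nat) (A : 'M[R]_n)
    (l : 'I_n -> R) : Prop :=
  char_poly A = \prod_(i < n) ('X - (l i)%:P).

Definition norm2 (R : realType) (n : nat) (u : 'cV[R]_n) : R :=
  Num.sqrt (\sum_(i < n) u i 0 ^+ 2).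

Definition unit_eigenvector (R : realType) (n : nat) (A : 'M[R]_n) (a : R)
    (u : 'cV[R]_n) : Prop :=
  A *m u = a *: u /\ norm2 u = 1.

(* "With probability at least p, E holds".  E is not required to be measurable:
   it has to contain a measurable event of probability at least p, which is
   equivalent to p <= P E when E is measurable. *)
Definition with_probability_at_least d (T : measurableType d) (R : realType)
    (P : probability T R) (p : R) (E : set T) : Prop :=
  exists A : set T, [/\ measurable A, A `<=` E & (p%:E <= P A)%E].

(* Main.v *)
Require Import Defs.
From mathcomp Require Import all_boot all_order all_algebra.
From mathcomp Require Import all_classical all_reals all_analysis.
From mathcomp Require Import ring lra.

Import Order.TTheory GRing.Theory Num.Theory.
Import numFieldNormedType.Exports.
From mathcomp Require Import complex.

(** Every eigenvector entry is dominated by a diagonal entry of the resolvent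
    G(z) = (W - z)^-1.  If W u = lam u with |u| = 1 and z = E + i eta satisfies
    |lam - E| <= eta, then u_i^2 <= 2 eta Im G_ii(z) ([eigenvector_entry_le]).
    So it suffices to show that, with the required probability, |G_ii(z)| is
    bounded by an absolute constant down to the scale eta = K log n / n, for E
    in a polynomial grid that covers the spectrum.  This gives
    u_i^2 = O(log n / n) for all eigenvalues at once, hence the bulk bound with
    a constant that does not depend on epsilon, and a fortiori the edge bound.

    To bound G_ii, let W^(i) be W with its i-th row and column replaced by
    zeros and let G^(i) be its resolvent.  The Schur complement formula reads
    1 / G_ii = W_ii - z - a^T G^(i) a, where a is the i-th row of W without its
    i-th entry ([schur_complement]).  Since a consists of independent signs
    divided by sqrt n, and is independent of G^(i), the quadratic form
    concentrates around n^-1 tr G^(i), which is within 1 / (n eta) of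
    m = n^-1 tr G ([trace_minor_le]).  Thus G_ii = 1 / (s + small), where
    s = - z - m.  Averaging over i, s almost solves s + 1/s = - z.  This
    equation has two roots whose product is 1, and the resolvent is bounded as
    long as s does not follow the root of small modulus.  At eta >= 3 the
    modulus of s is large; as eta decreases along a fine grid, s moves slowly
    ([resolvent_lipschitz]) and cannot cross a well chosen threshold
    ([no_intermediate_modulus], [local_law]).

    The concentration must be of Hanson-Wright type with Gaussian tails
    governed by the Frobenius norm: since the squared Frobenius norm of
    G^(i) / n is Im m / (n eta) by Ward's identity ([ward]) and its operator
    norm is at most 1 / (n eta) ([resolvent_form_le]), the failure probability
    at a fixed z is exp (- c n eta), a large negative power of n when
    n eta = K log n.  The exponential moment [hanson_wright_mgf] is proved by
    integrating out one sign at a time: by cosh t <= exp (2 t^2) this turns the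
    quadratic form into a form in one variable less, changed by a rank one
    matrix, and the operator norm bound survives this change while the
    Frobenius norm pays for the increase of the trace.

    The probability space enters only through the law of the matrix: all sign
    patterns above the diagonal are equally likely
    ([sign_matrix_probability]), so that failure probabilities are counted.
    Conditioning on W^(i) becomes averaging over the flips of the signs in
    row i, which permute the patterns ([sum_flip]). *)

Local Open Scope classical_set_scope.
Local Open Scope ring_scope.

(** * Exponential moments of Rademacher quadratic forms *)

Section SignAverage.
Context {R : realType}.

Definition ocons {n} (x : R) (v : 'I_n -> R) : 'I_n.+1 -> R :=
  fun i => oapp v x (unlift ord0 i).

Lemma ocons0 n x (v : 'I_n -> R) : ocons x v ord0 = x.
Proof. by rewrite /ocons unlift_none. Qed.

Lemma ocons_lift n x (v : 'I_n -> R) i : ocons x v (lift ord0 i) = v i.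
Proof. by rewrite /ocons liftK. Qed.

(** Expectation of f over independent uniform signs, defined by recursion on the
    dimension because the exponential moment bound below removes one coordinate
    at a time. *)
Fixpoint sign_avg (n : nat) : (('I_n -> R) -> R) -> R :=
  match n with
  | 0 => fun f => f (fun=> 1)
  | n.+1 => fun f => (sign_avg n (fun v => f (ocons 1 v)) +
                      sign_avg n (fun v => f (ocons (-1) v))) / 2
  end.

Definition sign_vector {n} (v : 'I_n -> R) := forall i, v i = 1 \/ v i = -1.

Lemma sign_vector_ocons n e (v : 'I_n -> R) :
  e = 1 \/ e = -1 -> sign_vector v -> sign_vector (ocons e v).
Proof.
move=> he hv i; case: (unliftP ord0 i) => [j|] ->; first by rewrite ocons_lift.
by rewrite ocons0.
Qed.

Lemma sign_avg_le n (f g : ('I_n -> R) -> R) :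
  (forall v, sign_vector v -> f v <= g v) -> sign_avg n f <= sign_avg n g.
Proof.
elim: n f g => [|n IH] f g fg /=; first by apply: fg => -[].
rewrite ler_pM2r ?invr_gt0//; apply: lerD; apply: IH => v hv; apply: fg.
  by apply: sign_vector_ocons => //; left.
by apply: sign_vector_ocons => //; right.
Qed.

Lemma sign_avgZ n c (f : ('I_n -> R) -> R) :
  sign_avg n (fun v => c * f v) = c * sign_avg n f.
Proof. by elim: n f => [|n IH] f //=; rewrite !IH -mulrDr mulrA. Qed.

Lemma sign_avgD n (f g : ('I_n -> R) -> R) :
  sign_avg n (fun v => f v + g v) = sign_avg n f + sign_avg n g.
Proof. by elim: n f g => [|n IH] f g //=; rewrite !IH; lra. Qed.

Lemma sign_avg_cst n (c : R) : sign_avg n (fun=> c) = c.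
Proof. by elim: n => [|n IH] //=; rewrite !IH; lra. Qed.

Lemma sign_avg_sum n (I : finType) (r : pred I) (F : I -> ('I_n -> R) -> R) :
  sign_avg n (fun v => \sum_(i | r i) F i v) = \sum_(i | r i) sign_avg n (F i).
Proof.
elim: n F => [|n IH] F //=.
by rewrite !IH -big_split /= mulr_suml.
Qed.

Lemma sign_avg_eq n (f g : ('I_n -> R) -> R) :
  (forall v, sign_vector v -> f v = g v) -> sign_avg n f = sign_avg n g.
Proof.
by move=> fg; apply/eqP; rewrite eq_le; apply/andP; split; apply: sign_avg_le
  => v /fg ->.
Qed.

Definition dotp {n} (u v : 'I_n -> R) := \sum_i u i * v i.

Definition qform {n} (A : 'I_n -> 'I_n -> R) (v : 'I_n -> R) :=
  \sum_i \sum_j A i j * v i * v j.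

Definition fro2 {n} (A : 'I_n -> 'I_n -> R) := \sum_i \sum_j A i j ^+ 2.

(** For x^2 <= 1/2, from exp x <= 1 / (1 - x) one gets cosh x <= 1 / (1 - x^2)
    <= 1 + 2 x^2; for larger x, |x| <= 2 x^2 already. *)
Lemma cosh_le (x : R) : (expR x + expR (- x)) / 2 <= expR (2 * x ^+ 2).
Proof.
have [x2|x2] := leP (x ^+ 2) (1/2); last first.
  have hx y : y ^+ 2 = x ^+ 2 -> expR y <= expR (2 * x ^+ 2).
    by move=> yx; rewrite ler_expR; nra.
  by have := hx x erefl; have := hx (- x) (sqrrN _); lra.
have hx y : y ^+ 2 = x ^+ 2 -> expR y * (1 - y) <= 1.
  move=> yx; have := expR_ge1Dx (- y); have := expR_gt0 y => e0 e1.
  have : expR y * expR (- y) = 1 by rewrite -expRD subrr expR0.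
  nra.
have e1 := hx x erefl; have e2 := hx (- x) (sqrrN _).
have e3 := expR_ge1Dx (2 * x ^+ 2).
have xlt1 : x < 1 by nra.
have xgtN1 : -1 < x by nra.
have e4 : (expR x + expR (- x)) / 2 * (1 - x ^+ 2) <= 1.
  have f1 : expR x * (1 - x) * (1 + x) <= 1 + x by nra.
  have f2 : expR (- x) * (1 - - x) * (1 - x) <= 1 - x by nra.
  nra.
apply: le_trans e3.
rewrite -(@ler_pM2r _ (1 - x ^+ 2)); last by nra.
nra.
Qed.

Lemma qform_ocons n (A : 'I_n.+1 -> 'I_n.+1 -> R) y (v : 'I_n -> R) :
  (forall i j, A i j = A j i) ->
  qform A (ocons y v) = A ord0 ord0 * y ^+ 2
    + 2 * y * dotp (fun i => A ord0 (lift ord0 i)) v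
    + qform (fun i j => A (lift ord0 i) (lift ord0 j)) v.
Proof.
move=> symA; rewrite /qform big_ord_recl /= big_ord_recl ocons0.
rewrite (eq_bigr (fun j => A ord0 (lift ord0 j) * y * v j)); last first.
  by move=> j _; rewrite ocons_lift.
rewrite [X in _ + X](eq_bigr (fun i => A (lift ord0 i) ord0 * v i * y +
    \sum_j A (lift ord0 i) (lift ord0 j) * v i * v j)); last first.
  move=> i _; rewrite big_ord_recl ocons0 ocons_lift; congr (_ + _).
  by apply: eq_bigr => j _; rewrite ocons_lift.
rewrite big_split /= -addrA -[RHS]addrA; congr (_ + _); first by rewrite expr2 mulrA.
rewrite addrA; congr (_ + _).
rewrite /dotp mulr_sumr -big_split /=; apply: eq_bigr => i _.
by rewrite (symA (lift ord0 i)); ring.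
Qed.

Lemma fro2_recl n (A : 'I_n.+1 -> 'I_n.+1 -> R) :
  (forall i j, A i j = A j i) ->
  let b := fun i => A ord0 (lift ord0 i) in
  fro2 A = A ord0 ord0 ^+ 2 + 2 * dotp b b
    + fro2 (fun i j => A (lift ord0 i) (lift ord0 j)).
Proof.
move=> symA b; rewrite /fro2 big_ord_recl /= big_ord_recl.
under [X in _ + X]eq_bigr do rewrite big_ord_recl.
rewrite big_split /= -addrA -[RHS]addrA; congr (_ + _).
rewrite addrA; congr (_ + _).
rewrite /dotp mulr_sumr -big_split /=; apply: eq_bigr => i _.
by rewrite (symA (lift ord0 i)) /b; ring.
Qed.

Lemma dotp_ge0 n (u : 'I_n -> R) : 0 <= dotp u u.
Proof. by apply: sumr_ge0 => i _; rewrite -expr2 sqr_ge0. Qed.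

Lemma dotp_sqr n (u v : 'I_n -> R) :
  dotp u v ^+ 2 = \sum_i \sum_j (u i * v i) * (u j * v j).
Proof.
by rewrite expr2 mulr_suml; apply: eq_bigr => i _; rewrite mulr_sumr.
Qed.

Lemma qform_rank1 n (A : 'I_n -> 'I_n -> R) c b v :
  qform (fun i j => A i j + c * (b i * b j)) v = qform A v + c * dotp b v ^+ 2.
Proof.
rewrite /qform dotp_sqr mulr_sumr -big_split; apply: eq_bigr => i _.
rewrite mulr_sumr -big_split.
by apply: eq_bigr => j _ /=; ring.
Qed.

Lemma fro2_rank1 n (A : 'I_n -> 'I_n -> R) c b :
  fro2 (fun i j => A i j + c * (b i * b j)) =
  fro2 A + 2 * c * qform A b + c ^+ 2 * dotp b b ^+ 2.
Proof.
rewrite /fro2 /qform dotp_sqr !mulr_sumr -!big_split; apply: eq_bigr => i _.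
rewrite !mulr_sumr -!big_split /=.
by apply: eq_bigr => j _ /=; ring.
Qed.

(** Induction on the dimension. Averaging over the first sign replaces A by its
    minor plus 8 theta b b^T, b being the rest of the first row. The form bound
    kappa survives: the bound for A at a suitable first coordinate exceeds that
    of the minor by a multiple of (b . v)^2 which, as 16 theta kappa <= 1, makes
    room for the rank one term. The trace grows by 8 theta |b|^2, while the
    squared Frobenius norm drops by at least |b|^2, which balances the exponent
    exactly. *)
Theorem hanson_wright_mgf n (A : 'I_n -> 'I_n -> R) (kappa theta : R) :
  (forall i j, A i j = A j i) -> 0 < kappa -> 0 <= theta ->
  16 * theta * kappa <= 1 ->
  (forall v, `|qform A v| <= kappa * dotp v v) ->
  sign_avg n (fun v => expR (theta * qform A v)) <=
  expR (theta * \sum_i A i i + 8 * theta ^+ 2 * fro2 A).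
Proof.
move=> symA k0 t0 tk; elim: n A symA => [|n IH] A symA hA.
  by rewrite /= /qform /fro2 !big_ord0 !mulr0 addr0.
pose b i := A ord0 (lift ord0 i).
pose A1 i j := A (lift ord0 i) (lift ord0 j).
pose A2 i j := A1 i j + 8 * theta * (b i * b j).
have symA2 i j : A2 i j = A2 j i.
  by rewrite /A2 /A1 symA (mulrC (b i)).
have hq y v : `|A ord0 ord0 * y ^+ 2 + 2 * y * dotp b v + qform A1 v| <=
    kappa * (y ^+ 2 + dotp v v).
  rewrite -qform_ocons//; apply: le_trans (hA _) _.
  rewrite /dotp big_ord_recl ocons0 -expr2.
  by under eq_bigr do rewrite ocons_lift.
have hA2 v : `|qform A2 v| <= kappa * dotp v v.
  rewrite qform_rank1 -/(A1) ler_norml; apply/andP; split.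
    (* The lower bound only improves, as the added rank one form is nonnegative. *)
    have := hq 0 v; rewrite expr0n /= !mulr0 !mul0r !add0r ler_norml.
    by move=> /andP[q1 _]; have := sqr_ge0 (dotp b v); nra.
  (* At first coordinate y = (b . v) / (2 kappa) the cross term 2 y (b . v) gives
     (b . v)^2 / kappa; since A_00 >= - kappa, the terms in y^2 cost at most half
     of this. *)
  have := hq ((2 * kappa)^-1 * dotp b v) v.
  have a_ge : - kappa <= A ord0 ord0.
    have d0 (u : 'I_n -> R) : dotp u (fun=> 0) = 0.
      by rewrite /dotp big1// => i _; rewrite mulr0.
    have q0 : qform A1 (fun=> 0) = 0.
      by rewrite /qform big1// => i _; rewrite big1// => j _; rewrite mulr0.
    have := hq 1 (fun=> 0); rewrite !d0 q0 ler_norml => /andP[+ _].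
    lra.
  rewrite ler_norml => /andP[_].
  set be := dotp b v; set Q := qform _ v; set N := dotp v v; set a := A _ _ in a_ge *.
  set t := (2 * kappa)^-1.
  have tk1 : t * kappa = 2^-1 by rewrite /t invfM -mulrA mulVf ?mulr1 ?gt_eqF.
  have t_gt0 : 0 < t by rewrite invr_gt0; lra.
  have -> : a * (t * be) ^+ 2 + 2 * (t * be) * be + Q =
     Q + be ^+ 2 * (a * t ^+ 2 + 2 * t) by ring.
  have -> : kappa * ((t * be) ^+ 2 + N) = kappa * N + be ^+2 * (t * kappa * t) by ring.
  rewrite tk1 => H.
  suff : be ^+ 2 * (8 * theta) <= be ^+ 2 * (a * t ^+ 2 + 2 * t - 2^-1 * t) by nra.
  apply: ler_wpM2l; first exact: sqr_ge0.
  have : - (2^-1 * t) <= a * t ^+ 2.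
    rewrite -tk1; have : 0 <= (a + kappa) * t ^+ 2.
      by rewrite mulr_ge0 ?sqr_ge0//; lra.
    lra.
  have : 8 * theta <= t.
    rewrite -(ler_pM2r k0) tk1; lra.
  lra.
have -> : sign_avg n.+1 (fun v => expR (theta * qform A v)) =
    sign_avg n (fun v => (expR (2 * theta * dotp b v) + expR (- (2 * theta * dotp b v))) / 2 *
      expR (theta * (A ord0 ord0 + qform A1 v))).
  rewrite /= -sign_avgD mulrC -sign_avgZ; apply: sign_avg_eq => v _.
  rewrite !qform_ocons// -/b -/A1 !sqrrN !expr1n !mulr1.
  rewrite [LHS]mulrC [RHS]mulrAC; congr (_ * _).
  rewrite [RHS]mulrDl -!expRD; congr (expR _ + expR _); ring.
have step v : sign_vector v ->
  (expR (2 * theta * dotp b v) + expR (- (2 * theta * dotp b v))) / 2 *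
      expR (theta * (A ord0 ord0 + qform A1 v)) <=
  expR (theta * A ord0 ord0) * expR (theta * qform A2 v).
  move=> _; rewrite -expRD.
  apply: le_trans (_ : expR (2 * (2 * theta * dotp b v) ^+ 2) *
    expR (theta * (A ord0 ord0 + qform A1 v)) <= _).
    by rewrite ler_wpM2r ?cosh_le ?expR_ge0.
  by rewrite -expRD ler_expR qform_rank1; lra.
apply: le_trans (sign_avg_le _ _ _ step) _.
rewrite sign_avgZ.
apply: le_trans (_ : expR (theta * A ord0 ord0) *
   expR (theta * (\sum_i A2 i i) + 8 * theta ^+ 2 * fro2 A2) <= _).
  by rewrite ler_wpM2l ?expR_ge0//; apply: IH.
rewrite -expRD ler_expR.
have trE : \sum_i A2 i i = \sum_i A1 i i + 8 * theta * dotp b b.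
  by rewrite big_split /= -mulr_sumr.
have froE : fro2 A2 <= fro2 A - dotp b b.
  have h2 := hA2 b; rewrite qform_rank1 in h2.
  rewrite fro2_rank1 (fro2_recl _ _ symA) -/b -/A1.
  move: h2; rewrite ler_norml => /andP[_].
  have := sqr_ge0 (A ord0 ord0); have := dotp_ge0 _ b.
  set B := dotp b b; set Q := qform _ b => B0 a2 hQ.
  have : 16 * theta * (Q + 8 * theta * B ^+ 2) <= B.
    apply: le_trans (_ : 16 * theta * (kappa * B) <= _).
      by rewrite ler_wpM2l//; lra.
    by rewrite mulrA -[leRHS]mul1r ler_wpM2r.
  have : 0 <= theta ^+ 2 * B ^+ 2 by rewrite mulr_ge0 ?sqr_ge0.
  lra.
rewrite trE big_ord_recl /=.
have -> : \sum_(i < n) A (lift ord0 i) (lift ord0 i) = \sum_i A1 i i by [].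
have : 8 * theta ^+ 2 * fro2 A2 <= 8 * theta ^+ 2 * (fro2 A - dotp b b).
  by rewrite ler_wpM2l// mulr_ge0 ?sqr_ge0.
lra.
Qed.

End SignAverage.

(** * Resolvents of real symmetric matrices *)

Section Modulus.
Context {R : realType}.
Local Notation C := R[i].
Local Notation modulus := (@Normc.normc R).
Implicit Types z : C.

Lemma Re_add z1 z2 : Re (z1 + z2) = Re z1 + Re z2. Proof. by case: z1 z2 => ? ? []. Qed.
Lemma Im_add z1 z2 : Im (z1 + z2) = Im z1 + Im z2. Proof. by case: z1 z2 => ? ? []. Qed.
Lemma Re_opp z : Re (- z) = - Re z. Proof. by case: z. Qed.
Lemma Im_opp z : Im (- z) = - Im z. Proof. by case: z. Qed.
Lemma Re_mul z1 z2 : Re (z1 * z2) = Re z1 * Re z2 - Im z1 * Im z2.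
Proof. by case: z1 z2 => ? ? []. Qed.
Lemma Im_mul z1 z2 : Im (z1 * z2) = Re z1 * Im z2 + Im z1 * Re z2.
Proof. by case: z1 z2 => ? ? [? ?] /=. Qed.
Lemma Re_sum (I : Type) (r : seq I) (P : pred I) (F : I -> C) :
  Re (\sum_(i <- r | P i) F i) = \sum_(i <- r | P i) Re (F i).
Proof. by apply: (big_morph _ Re_add). Qed.
Lemma Im_sum (I : Type) (r : seq I) (P : pred I) (F : I -> C) :
  Im (\sum_(i <- r | P i) F i) = \sum_(i <- r | P i) Im (F i).
Proof. by apply: (big_morph _ Im_add). Qed.

Lemma sqr_modulus z : modulus z ^+ 2 = Re z ^+ 2 + Im z ^+ 2.
Proof. by case: z => a b /=; rewrite sqr_sqrtr// addr_ge0 ?sqr_ge0. Qed.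
Lemma modulus_ge0 z : 0 <= modulus z. Proof. by case: z => a b; apply: sqrtr_ge0. Qed.
Lemma modulus_real (x : R) : modulus x%:C%C = `|x|.
Proof. by rewrite /= expr0n addr0 sqrtr_sqr. Qed.
Lemma modulusD z1 z2 : modulus (z1 + z2) <= modulus z1 + modulus z2.
Proof. exact: le_normcD. Qed.
Lemma modulusN z : modulus (- z) = modulus z. Proof. exact: normcN. Qed.
Lemma modulusB z1 z2 : modulus (z1 - z2) = modulus (z2 - z1).
Proof. by rewrite -modulusN opprB. Qed.
Lemma modulus_sum (I : Type) (r : seq I) (P : pred I) (F : I -> C) :
  modulus (\sum_(i <- r | P i) F i) <= \sum_(i <- r | P i) modulus (F i).
Proof.
elim/big_ind2 : _ => //; first by rewrite Normc.normc0.
by move=> z1 x1 z2 x2 h1 h2; apply: le_trans (modulusD _ _) (lerD h1 h2).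
Qed.
Lemma modulus_geIm z : Im z <= modulus z.
Proof. by have := sqr_modulus z; have := modulus_ge0 z; nra. Qed.
Lemma modulus_geNIm z : - Im z <= modulus z.
Proof. by have := sqr_modulus z; have := modulus_ge0 z; nra. Qed.
Lemma modulus_geRe z : Re z <= modulus z.
Proof. by have := sqr_modulus z; have := modulus_ge0 z; nra. Qed.
Lemma modulus_le (z : C) : modulus z <= `|Re z| + `|Im z|.
Proof.
have := sqr_modulus z; have := modulus_ge0 z.
rewrite -(real_normK (num_real (Re z))) -(real_normK (num_real (Im z))).
have := normr_ge0 (Re z); have := normr_ge0 (Im z); nra.
Qed.

Lemma cauchy_schwarz n (a b : 'I_n -> R) :
  (\sum_i a i * b i) ^+ 2 <= (\sum_i a i ^+ 2) * (\sum_i b i ^+ 2).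
Proof.
have : 0 <= \sum_i \sum_j (a i * b j - a j * b i) ^+ 2.
  by apply: sumr_ge0 => i _; apply: sumr_ge0 => j _; rewrite sqr_ge0.
have -> : \sum_i \sum_j (a i * b j - a j * b i) ^+ 2 =
  \sum_i \sum_j (a i ^+ 2 * b j ^+ 2) + \sum_j \sum_i (a i ^+ 2 * b j ^+ 2)
  - 2 * \sum_i \sum_j (a i * b i) * (a j * b j).
  rewrite mulr_sumr -sumrN -!big_split; apply: eq_bigr => i _ /=.
  by rewrite mulr_sumr -sumrN -!big_split; apply: eq_bigr => j _ /=; ring.
have e1 : \sum_i \sum_j (a i ^+ 2 * b j ^+ 2) = (\sum_i a i ^+ 2) * (\sum_i b i ^+ 2).
  by rewrite mulr_suml; apply: eq_bigr => i _; rewrite mulr_sumr.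
have e2 : \sum_i \sum_j (a i * b i) * (a j * b j) = (\sum_i a i * b i) ^+ 2.
  by rewrite expr2 mulr_suml; apply: eq_bigr => i _; rewrite mulr_sumr.
rewrite e2 [X in _ + X - _]exchange_big e1; lra.
Qed.

Lemma cauchy_schwarz_modulus n (a b : 'I_n -> C) :
  modulus (\sum_i a i * b i) ^+ 2 <= (\sum_i modulus (a i) ^+ 2) * (\sum_i modulus (b i) ^+ 2).
Proof.
apply: le_trans (cauchy_schwarz _ _ _).
apply: ler_pM; rewrite ?modulus_ge0//; apply: le_trans (modulus_sum _ _ _ _) _;
  by under eq_bigr do rewrite Normc.normcM.
Qed.

End Modulus.

Section Resolvent.
Context {R : realType}.
Local Notation C := R[i].
Local Notation modulus := (@Normc.normc R).

Definition resolvent {n} (A : 'M[R]_n) (z : C) : 'M[C]_n :=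
  invmx (map_mx (real_complex R) A - z%:M).

Section One.
Variables (n : nat) (A : 'M[R]_n) (E eta : R).
Hypotheses (symA : forall i j, A i j = A j i) (eta0 : 0 < eta).
Local Notation z := (Complex E eta).
Local Notation G := (resolvent A z).

(** Imaginary part of the inner product of v with w = (A - z) v: as A is real
    symmetric, only z contributes. Invertibility of A - z, Ward's identity and
    the operator norm bound are all instances. *)
Lemma energy_identity (v w : 'I_n -> C) :
  (forall i, \sum_j (A i j)%:C%C * v j - z * v i = w i) ->
  \sum_i (Im (v i) * Re (w i) - Re (v i) * Im (w i)) = eta * \sum_i modulus (v i) ^+ 2.
Proof.
move=> vw.
have wE i : Im (v i) * Re (w i) - Re (v i) * Im (w i) =
   \sum_j A i j * (Im (v i) * Re (v j) - Re (v i) * Im (v j)) + eta * modulus (v i) ^+ 2.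
  rewrite -vw Re_add Im_add Re_opp Im_opp Re_mul Im_mul Re_sum Im_sum sqr_modulus /=.
  rewrite (eq_bigr (fun j => A i j * Re (v j))); last first.
    by move=> j _; rewrite Re_mul /= mul0r subr0.
  rewrite [X in _ - _ * (X + _)](eq_bigr (fun j => A i j * Im (v j))); last first.
    by move=> j _; rewrite Im_mul /= mul0r addr0.
  have -> : \sum_j A i j * (Im (v i) * Re (v j) - Re (v i) * Im (v j)) =
     Im (v i) * (\sum_j A i j * Re (v j)) - Re (v i) * (\sum_j A i j * Im (v j)).
    by rewrite !mulr_sumr -sumrN -big_split; apply: eq_bigr => j _ /=; ring.
  ring.
under eq_bigr do rewrite wE.
rewrite big_split /= -mulr_sumr.
set S := \sum_i \sum_j _.
suff : S = - S by lra.
rewrite {1}/S exchange_big /= -sumrN; apply: eq_bigr => i _.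
by rewrite -sumrN; apply: eq_bigr => j _; rewrite symA; ring.
Qed.

Lemma resolvent_unit : map_mx (real_complex R) A - z%:M \in unitmx.
Proof.
rewrite -unitmx_tr -row_free_unit -kermx_eq0.
apply/rowV0P => v /sub_kermxP /matrixP vB.
have vw i : \sum_j (A i j)%:C%C * v 0 j - z * v 0 i = (0 : C).
  have := vB 0 i; rewrite !mxE => h; rewrite -[RHS]h.
  under [RHS]eq_bigr do rewrite !mxE mulrBr.
  rewrite sumrB; congr (_ - _); first by apply: eq_bigr => j _; rewrite mulrC.
  rewrite (bigD1 i)//= eqxx mulr1n mulrC big1 ?addr0// => j /negPf ji.
  by rewrite eq_sym ji mulr0n mulr0.
have := energy_identity _ _ vw; rewrite big1; last by move=> i _; rewrite !mulr0 subrr.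
move=> /esym/eqP; rewrite mulf_eq0 gt_eqF//= psumr_eq0; last by move=> i _; rewrite sqr_ge0.
move=> /allP v0; apply/rowP => i; rewrite mxE; apply: Normc.eq0_normc.
by have := v0 i (mem_index_enum _); rewrite sqrf_eq0 => /eqP.
Qed.

Lemma resolvent_eq i k :
  \sum_j (A i j)%:C%C * G j k - z * G i k = (i == k)%:R.
Proof.
have /matrixP/(_ i k) := mulmxV resolvent_unit.
rewrite !mxE -/G => <-.
under [RHS]eq_bigr do rewrite !mxE mulrBl.
rewrite sumrB; congr (_ - _).
rewrite (bigD1 i)//= eqxx mulr1n big1 ?addr0// => j /negPf ji.
by rewrite eq_sym ji mulr0n mul0r.
Qed.

(** With [resolvent_eq], all that is used about the inverse matrix: a solution v
    of (A - z) v = w is G w. *)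
Lemma resolvent_uniq (v w : 'I_n -> C) :
  (forall i, \sum_j (A i j)%:C%C * v j - z * v i = w i) ->
  forall i, v i = \sum_j G i j * w j.
Proof.
move=> vw i.
have /(congr1 (mulmx G)) : (map_mx (real_complex R) A - z%:M) *m (\col_j v j) = \col_j w j.
  apply/colP => j; rewrite !mxE -vw.
  under eq_bigr do rewrite !mxE mulrBl.
  rewrite sumrB; congr (_ - _).
  rewrite (bigD1 j)//= eqxx mulr1n big1 ?addr0// => k /negPf ji.
  by rewrite eq_sym ji mulr0n mul0r.
rewrite mulmxA mulVmx ?resolvent_unit// mul1mx => /matrixP/(_ i 0).
by rewrite !mxE => ->; apply: eq_bigr => j _; rewrite mxE.
Qed.

Lemma resolvent_sym i j : G i j = G j i.
Proof.
have /matrixP/(_ j i) : G^T = G; last by rewrite mxE.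
rewrite /resolvent trmx_inv; congr invmx.
by apply/matrixP => k l; rewrite !mxE symA eq_sym.
Qed.

(** Ward's identity: [energy_identity] for the k-th column of G, which A - z
    sends to the k-th basis vector. *)
Lemma ward k : Im (G k k) = eta * \sum_i modulus (G i k) ^+ 2.
Proof.
rewrite -(energy_identity _ _ (fun i => resolvent_eq i k)).
rewrite (bigD1 k)//= eqxx mulr1 mulr0 subr0 big1 ?addr0// => i /negPf ->.
by rewrite !mulr0 subrr.
Qed.

Lemma ward_sym k : Im (G k k) = eta * \sum_i modulus (G k i) ^+ 2.
Proof. by rewrite ward; congr (_ * _); apply: eq_bigr => i _; rewrite resolvent_sym. Qed.

Lemma Im_resolvent_ge0 k : 0 <= Im (G k k).
Proof.
rewrite ward; apply: mulr_ge0; first exact: ltW.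
by apply: sumr_ge0 => i _; exact: sqr_ge0.
Qed.

Lemma resolvent_diag_le k : eta * modulus (G k k) <= 1.
Proof.
have : eta * modulus (G k k) ^+ 2 <= Im (G k k).
  rewrite ward ler_pM2l// (bigD1 k)//= lerDl.
  by apply: sumr_ge0 => i _; exact: sqr_ge0.
have := modulus_geIm (G k k); have := modulus_ge0 (G k k).
move: (modulus _) => x; rewrite le_eqVlt => /orP[/eqP<-|x0 xy xx]; first by rewrite mulr0.
by rewrite -(ler_pM2r x0) mul1r; nra.
Qed.

Lemma resolvent_diag_neq0 k : G k k != 0.
Proof.
apply/eqP => Gk0; have := ward k; rewrite Gk0 => /esym/eqP.
rewrite mulf_eq0 gt_eqF//= psumr_eq0; last by move=> i _; rewrite sqr_ge0.
move=> /allP h.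
have G0 i : G i k = 0.
  apply: Normc.eq0_normc; have := h i (mem_index_enum _).
  by rewrite sqrf_eq0 => /eqP.
have := resolvent_eq k k; rewrite eqxx G0 mulr0 subr0 big1.
  by move/esym/eqP; rewrite oner_eq0.
by move=> j _; rewrite G0 mulr0.
Qed.

(** The operator norm of G is at most 1 / eta, in the form needed for real
    vectors. With v = G x, the energy identity gives eta |v|^2 = Im (v . x) <=
    |v . x|, and |v . x| <= |v| |x|. *)
Lemma resolvent_form_le (x : 'I_n -> R) :
  eta * modulus (\sum_i \sum_j G i j * (x i)%:C%C * (x j)%:C%C) <= dotp x x.
Proof.
pose v i := \sum_j G i j * (x j)%:C%C.
have vw i : \sum_j (A i j)%:C%C * v j - z * v i = (x i)%:C%C.
  rewrite /v mulr_sumr.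
  under eq_bigr do rewrite mulr_sumr.
  rewrite exchange_big -sumrB /=.
  rewrite (eq_bigr (fun k => (i == k)%:R * (x k)%:C%C)).
    rewrite (bigD1 i)//= eqxx mul1r big1 ?addr0// => j /negPf ji.
    by rewrite eq_sym ji mul0r.
  move=> k _; rewrite -resolvent_eq mulrBl mulr_suml mulrA; congr (_ - _).
  by apply: eq_bigr => j _; rewrite mulrA.
have SE : \sum_i \sum_j G i j * (x i)%:C%C * (x j)%:C%C = \sum_i v i * (x i)%:C%C.
  by apply: eq_bigr => i _; rewrite mulr_suml; apply: eq_bigr => j _; ring.
have ImS : Im (\sum_i v i * (x i)%:C%C) = eta * \sum_i modulus (v i) ^+ 2.
  rewrite -(energy_identity _ _ vw) Im_sum; apply: eq_bigr => i _.
  by rewrite Im_mul /=; ring.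
have := cauchy_schwarz_modulus _ v (fun i => (x i)%:C%C).
have -> : \sum_i modulus (x i)%:C%C ^+ 2 = dotp x x.
  apply: eq_bigr => i _; rewrite modulus_real -expr2 real_normK ?num_real//.
rewrite SE => CS.
have := modulus_geIm (\sum_i v i * (x i)%:C%C); rewrite ImS.
have := dotp_ge0 _ x; have := modulus_ge0 (\sum_i v i * (x i)%:C%C).
move: CS; set S := modulus _; set V := \sum_i modulus _ ^+ 2; set X := dotp x x.
move=> CS S0 X0 VS.
have : eta * S ^+ 2 <= S * X.
  have h : eta * S ^+ 2 <= eta * (V * X) by rewrite ler_pM2l.
  apply: le_trans h _; rewrite mulrA; exact: ler_wpM2r.
move: S0; rewrite le_eqVlt => /orP[/eqP<-|S0 h]; first by rewrite mulr0.
by rewrite -(ler_pM2r S0) (mulrC X); nra.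
Qed.

(** Since A - z multiplies u by lam - z, u = (lam - z) G u, and the i-th row of
    G has squared norm Im G_ii / eta. *)
Lemma eigenvector_entry_le (u : 'I_n -> R) lam i :
  (forall i, \sum_j A i j * u j = lam * u i) -> \sum_j u j ^+ 2 = 1 ->
  eta * u i ^+ 2 <= ((lam - E) ^+ 2 + eta ^+ 2) * Im (G i i).
Proof.
move=> Au u1.
have vw k : \sum_j (A k j)%:C%C * (u j)%:C%C - z * (u k)%:C%C =
    (lam%:C%C - z) * (u k)%:C%C.
  rewrite mulrBl -rmorphM /= -Au rmorph_sum /=; congr (_ - _).
  by apply: eq_bigr => j _; rewrite rmorphM.
have := resolvent_uniq _ _ vw i.
under eq_bigr do rewrite mulrCA.
rewrite -mulr_sumr => /(congr1 (fun x => modulus x ^+ 2)).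
rewrite modulus_real real_normK ?num_real// Normc.normcM exprMn => ->.
rewrite sqr_modulus Re_add Im_add Re_opp Im_opp /= add0r sqrrN.
have := cauchy_schwarz_modulus _ (G i) (fun k => (u k)%:C%C).
have -> : \sum_k modulus (u k)%:C%C ^+ 2 = 1.
  by rewrite -u1; apply: eq_bigr => k _; rewrite modulus_real real_normK ?num_real.
rewrite mulr1 ward_sym => CS.
rewrite mulrCA ler_wpM2l ?addr_ge0 ?sqr_ge0//.
by rewrite ler_pM2l.
Qed.

End One.

(** Resolvent identity G - G' = (z - z') G G' on the diagonal; rows and columns
    have norms at most 1 / eta and 1 / eta'. *)
Lemma resolvent_lipschitz n (A : 'M[R]_n) (E eta eta' : R) k :
  (forall i j, A i j = A j i) -> 0 < eta -> 0 < eta' ->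
  eta * eta' * modulus (resolvent A (Complex E eta) k k - resolvent A (Complex E eta') k k)
    <= `|eta - eta'|.
Proof.
move=> symA e0 e1.
set G := resolvent A _; set G' := resolvent A _.
have vw i : \sum_j (A i j)%:C%C * G' j k - Complex E eta * G' i k =
   (i == k)%:R + (Complex E eta' - Complex E eta) * G' i k.
  rewrite -(resolvent_eq _ _ E eta' symA e1) mulrBl addrA; congr (_ - _).
  by rewrite subrK.
have := resolvent_uniq _ _ _ _ symA e0 _ _ vw k.
rewrite -/G; under eq_bigr do rewrite mulrDr mulrCA.
rewrite big_split /= -mulr_sumr (bigD1 k)//= eqxx mulr1 [X in _ + X + _]big1 ?addr0; last first.
  by move=> j /negPf ->; rewrite mulr0.
move=> G'E; rewrite modulusB G'E addrAC subrr add0r Normc.normcM.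
have -> : modulus (Complex E eta' - Complex E eta) = `|eta - eta'|.
  by rewrite modulusB /= subrr expr0n add0r sqrtr_sqr.
rewrite mulrCA -[leRHS]mulr1; apply: ler_wpM2l => //.
have := cauchy_schwarz_modulus _ (G k) (G' ^~ k).
have h : eta ^+ 2 * (\sum_j modulus (G k j) ^+ 2) <= 1.
  rewrite expr2 -mulrA -ward_sym//.
  apply: le_trans (resolvent_diag_le _ _ E eta symA e0 k).
  by rewrite ler_pM2l//; exact: modulus_geIm.
have h' : eta' ^+ 2 * (\sum_j modulus (G' j k) ^+ 2) <= 1.
  rewrite expr2 -mulrA -ward//.
  apply: le_trans (resolvent_diag_le _ _ E eta' symA e1 k).
  by rewrite ler_pM2l//; exact: modulus_geIm.
have g0 : 0 <= eta ^+ 2 * (\sum_j modulus (G k j) ^+ 2).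
  by rewrite mulr_ge0 ?sqr_ge0// sumr_ge0// => j _; rewrite sqr_ge0.
have g0' : 0 <= eta' ^+ 2 * (\sum_j modulus (G' j k) ^+ 2).
  by rewrite mulr_ge0 ?sqr_ge0// sumr_ge0// => j _; rewrite sqr_ge0.
move=> CS; rewrite -(@ler_pXn2r _ 2)// ?nnegrE ?mulr_ge0 ?modulus_ge0 ?(ltW e0) ?(ltW e1)//.
rewrite expr1n !exprMn.
apply: le_trans (_ : eta ^+ 2 * eta' ^+ 2 *
    ((\sum_j modulus (G k j) ^+ 2) * (\sum_j modulus (G' j k) ^+ 2)) <= _).
  by rewrite ler_wpM2l// mulr_ge0 ?sqr_ge0.
rewrite mulrACA; rewrite -[leRHS]mulr1; exact: ler_pM.
Qed.

(** Zeroing a row and a column instead of deleting them keeps the index type;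
    the resolvent only acquires the extra diagonal entry - 1/z at i. *)
Definition zero_cross {n} (A : 'M[R]_n) (i : 'I_n) : 'M[R]_n :=
  \matrix_(j, k) (if (j == i) || (k == i) then 0 else A j k).

Section Minor.
Variables (n : nat) (A : 'M[R]_n) (E eta : R) (i : 'I_n).
Hypotheses (symA : forall i j, A i j = A j i) (eta0 : 0 < eta).
Local Notation z := (Complex E eta).
Local Notation G := (resolvent A z).
Local Notation G0 := (resolvent (zero_cross A i) z).

Lemma zero_cross_sym j k : zero_cross A i j k = zero_cross A i k j.
Proof. by rewrite !mxE symA orbC. Qed.

Lemma zero_cross_apply (v : 'I_n -> C) j : v i = 0 -> j != i ->
  \sum_k (zero_cross A i j k)%:C%C * v k = \sum_k (A j k)%:C%C * v k.
Proof.
move=> vi ji; apply: eq_bigr => k _; rewrite mxE (negPf ji) /=.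
by case: eqP => [->|//]; rewrite vi !mulr0.
Qed.

Lemma zero_cross_apply_i (v : 'I_n -> C) :
  \sum_k (zero_cross A i i k)%:C%C * v k = 0.
Proof. by apply: big1 => k _; rewrite mxE eqxx /= mul0r. Qed.

(** The right-hand side, as a vector in j, vanishes at i and solves the equation
    that characterises the k-th column of G0. *)
Lemma resolvent_minor j k : k != i ->
  G0 j k = G j k - G j i * (G i k / G i i).
Proof.
move=> ki; set c := G i k / G i i; pose v j := G j k - G j i * c.
have vi : v i = 0.
  by rewrite /v /c mulrCA mulfV ?mulr1 ?subrr//; exact: resolvent_diag_neq0.
have vw l : \sum_j (zero_cross A i l j)%:C%C * v j - z * v l = (l == k)%:R.
  have [->|li] := eqVneq l i.
    by rewrite zero_cross_apply_i vi mulr0 subrr eq_sym (negPf ki).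
  rewrite zero_cross_apply// -(resolvent_eq _ _ E _ symA eta0) /v.
  have := resolvent_eq _ _ E _ symA eta0 l i; rewrite (negPf li) => /eqP.
  rewrite subr_eq0 => /eqP e.
  under eq_bigr do rewrite mulrBr mulrA.
  by rewrite sumrB -mulr_suml e; ring.
rewrite -/(v j) (resolvent_uniq _ _ _ _ zero_cross_sym eta0 _ _ vw).
rewrite (bigD1 k)//= eqxx mulr1 big1 ?addr0// => l /negPf ->; by rewrite mulr0.
Qed.

(** By [resolvent_minor] the difference of traces is the sum of G_ji G_ij /
    G_ii, whose modulus is at most (sum_j |G_ji|^2) / |G_ii|; Ward's identity
    turns this into Im G_ii / (eta |G_ii|). *)
Lemma trace_minor_le :
  eta * modulus (\sum_j G j j - \sum_(j | j != i) G0 j j) <= 1.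
Proof.
have -> : \sum_j G j j - \sum_(j | j != i) G0 j j = \sum_j G j i * (G i j / G i i).
  under [X in _ - X]eq_bigr => j ji do rewrite resolvent_minor//.
  rewrite sumrB.
  rewrite (bigD1 i)//= [RHS](bigD1 i)//= mulfV ?mulr1; last exact: resolvent_diag_neq0.
  ring.
have Gi : 0 < modulus (G i i).
  rewrite lt_neqAle modulus_ge0 andbT eq_sym; apply/eqP => /Normc.eq0_normc/eqP.
  by rewrite (negPf (resolvent_diag_neq0 _ _ _ _ symA eta0 i)).
under eq_bigr do rewrite mulrA.
rewrite -(ler_pM2r Gi) mul1r -mulr_suml Normc.normcM Normc.normcV.
rewrite mulrA mulfVK ?gt_eqF//.
apply: le_trans (modulus_geIm _); rewrite ward// ler_pM2l//.
apply: le_trans (modulus_sum _ _ _ _) _; apply: ler_sum => j _.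
by rewrite (resolvent_sym _ _ _ _ symA i j) Normc.normcM expr2.
Qed.

(** Off i, the i-th column of G solves the equation of the minor with right-hand
    side - G_ii a; substituting the solution into the i-th row of (A - z) G = 1
    gives the formula. *)
Lemma schur_complement :
  G i i * ((A i i)%:C%C - z - \sum_(j | j != i) \sum_(k | k != i)
     G0 j k * (A i j)%:C%C * (A i k)%:C%C) = 1.
Proof.
pose v j := if j == i then 0 else - G j i.
pose w j := if j == i then 0 else (A i j)%:C%C * G i i.
have vw l : \sum_j (zero_cross A i l j)%:C%C * v j - z * v l = w l.
  have vi : v i = 0 by rewrite /v eqxx.
  rewrite /w; have [->|li] := eqVneq l i.
    by rewrite zero_cross_apply_i vi mulr0 subrr.
  rewrite zero_cross_apply//.
  have := resolvent_eq _ _ E _ symA eta0 l i; rewrite (negPf li).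
  rewrite (bigD1 i)//= => /eqP; rewrite -addrA addr_eq0 => /eqP.
  rewrite (symA i l) => ->.
  rewrite (bigD1 i)//= vi mulr0 add0r /v (negPf li) opprB mulrN opprK addrC.
  congr (_ + _); rewrite -sumrN; apply: eq_bigr => j /negPf ->.
  by rewrite mulrN.
have vE j : j != i -> G j i = - (G i i * \sum_(k | k != i) G0 j k * (A i k)%:C%C).
  move=> ji; have := resolvent_uniq _ _ _ _ zero_cross_sym eta0 _ _ vw j.
  rewrite {1}/v (negPf ji) => /eqP; rewrite eqr_oppLR => /eqP ->.
  congr (- _); rewrite (bigD1 i)//= /w eqxx mulr0 add0r mulr_sumr.
  by apply: eq_bigr => k /negPf ->; ring.
have := resolvent_eq _ _ E _ symA eta0 i i; rewrite eqxx => e; rewrite -[RHS]e.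
set Q := \sum_(j | j != i) _.
have SQ : \sum_(j | j != i) (A i j)%:C%C * G j i = - (G i i * Q).
  rewrite /Q mulr_sumr -sumrN; apply: eq_bigr => j ji.
  rewrite vE// mulrN; congr (- _); rewrite !mulr_sumr.
  by apply: eq_bigr => k _; ring.
by rewrite [in RHS](bigD1 i)//= SQ; ring.
Qed.

End Minor.
End Resolvent.

(** * The self-consistent equation for the resolvent *)

Section Stability.
Context {R : realType}.
Local Notation C := R[i].
Local Notation modulus := (@Normc.normc R).

Definition mean {n} (I : pred 'I_n) (f : 'I_n -> C) : C :=
  (n%:R^-1)%:C%C * \sum_(j | I j) f j.

Lemma modulus_mean_le n (f : 'I_n -> C) c : (0 < n)%N ->
  (forall i, modulus (f i) <= c) -> modulus (mean predT f) <= c.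
Proof.
move=> n0 fc; have n0R : 0 < n%:R :> R by rewrite ltr0n.
rewrite /mean Normc.normcM modulus_real ger0_norm ?invr_ge0 ?ler0n// mulrC.
rewrite ler_pdivrMr//; apply: le_trans (modulus_sum _ _ _ _) _.
by rewrite mulr_natr -[in leRHS](card_ord n) -sumr_const; apply: ler_sum.
Qed.

Lemma mean_cst n (c : C) : (0 < n)%N -> mean predT (fun _ : 'I_n => c) = c.
Proof.
move=> n0; rewrite /mean sumr_const cardT size_enum_ord -(mulr_natl c) mulrA.
rewrite -(rmorph_nat (real_complex R)) -rmorphM mulVf ?mul1r//.
by rewrite pnatr_eq0 -lt0n.
Qed.

Lemma meanB n (I : pred 'I_n) (f g : 'I_n -> C) :
  mean I (fun i => f i - g i) = mean I f - mean I g.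
Proof. by rewrite /mean sumrB mulrBr. Qed.

Lemma Im_mean n (I : pred 'I_n) (f : 'I_n -> C) :
  Im (mean I f) = n%:R^-1 * \sum_(j | I j) Im (f j).
Proof. by rewrite /mean Im_mul /= mul0r addr0 Im_sum. Qed.

(** Here s = p + i q and rho = |s|^-2, so that s + 1/s has real part p (1 + rho)
    and imaginary part q (1 - rho). If |s| < 3/4 then the imaginary part of the
    equation forces q to be tiny, so that |E| is nearly |s| + 1/|s|. For |s|
    just below 1/2 this is about 5/2, and just below 3/4 it is about 25/12.
    Whichever side of 47/20 contains |E|, one of the two thresholds cannot be
    crossed. *)
Lemma no_intermediate_modulus (E eta p q rho t : R) :
  rho * (p ^+ 2 + q ^+ 2) = 1 ->
  (t = 1 / 2 /\ `|E| <= 47 / 20) \/ (t = 3 / 4 /\ 47 / 20 <= `|E|) ->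
  0 < eta -> q <= 0 ->
  `|E + p * (1 + rho)| <= 1 / 200 -> `|eta + q * (1 - rho)| <= 1 / 200 ->
  (t - 1 / 50) ^+ 2 <= p ^+ 2 + q ^+ 2 -> t ^+ 2 <= p ^+ 2 + q ^+ 2.
Proof.
move=> rhoE ht eta0 q0 hE hq hr; rewrite leNgt; apply/negP => rt.
have p2 : p ^+ 2 = (p ^+ 2 + q ^+ 2) - q ^+ 2 by ring.
move: (p ^+ 2 + q ^+ 2) rhoE hr rt p2 => r2 rhoE hr rt p2.
have r2_gt : 23 / 100 < r2.
  by case: ht => -[tE _]; move: hr; rewrite tE; clear; lra.
have rho_gt (c d : R) : 0 <= c -> c * d = 1 -> r2 < d -> c < rho.
  move=> c0 cd rd; rewrite -(@ltr_pM2r _ r2); last by clear -r2_gt; lra.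
  rewrite rhoE -cd ltr_pM2l// lt_neqAle c0 andbT; apply/eqP => c1.
  by move: cd; rewrite -c1 mul0r => /esym/eqP; rewrite oner_eq0.
have rho_lt (c : R) : 1 < c * r2 -> rho < c.
  by move=> h; rewrite -(@ltr_pM2r _ r2) ?rhoE//; clear -r2_gt; lra.
have rho16 : 16 / 9 < rho.
  apply: (rho_gt _ (9 / 16)); [by clear; lra|by clear; lra|].
  by case: ht => -[tE _]; move: rt; rewrite tE; clear; lra.
move: hq; rewrite ler_norml => /andP[_ hq].
have q_small : q ^+ 2 <= 1 / 20000.
  have q1 : - q <= 7 / 1000.
    have h : - q * (7 / 9) <= - q * (rho - 1) by apply: ler_wpM2l; clear -q0 rho16; lra.
    by clear -hq eta0 h; lra.
  have : (- q) * (- q) <= (7 / 1000) * (7 / 1000).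
    by apply: ler_pM; clear -q0 q1; lra.
  by rewrite mulrNN -expr2; clear; lra.
pose x := `|p| * (1 + rho).
have x0 : 0 <= x by rewrite mulr_ge0//; clear -rho16; lra.
have x2 : x ^+ 2 = 2 + rho + r2 - q ^+ 2 * (1 + rho) ^+ 2.
  rewrite /x exprMn real_normK ?num_real// p2.
  have -> : (r2 - q ^+ 2) * (1 + rho) ^+ 2 =
    (rho * r2) * (2 + rho) + r2 - q ^+ 2 * (1 + rho) ^+ 2 by ring.
  by rewrite rhoE; ring.
have [xE1 xE2] : `|E| - 1 / 200 <= x /\ x - 1 / 200 <= `|E|.
  have -> : x = `|p * (1 + rho)| by rewrite normrM [X in _ * X]ger0_norm//; clear -rho16; lra.
  have := ler_normB (E + p * (1 + rho)) (p * (1 + rho)).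
  rewrite addrK => h1.
  have := ler_normB (E + p * (1 + rho)) E.
  rewrite addrAC subrr add0r => h2.
  by split; clear -hE h1 h2; lra.
case: ht => -[tE hEt]; rewrite tE in rt hr.
  have rho4 : 4 < rho by apply: (rho_gt _ (1 / 4)); clear -rt; lra.
  have rho5 : rho < 9 / 2 by apply: rho_lt; clear -r2_gt; lra.
  have q1 : q ^+ 2 * (1 + rho) ^+ 2 <= 1 / 20000 * 36.
    apply: ler_pM; rewrite ?sqr_ge0//.
    have : (1 + rho) * (1 + rho) <= 6 * 6 by apply: ler_pM; clear -rho4 rho5; lra.
    by rewrite -expr2; clear; lra.
  have : x * x <= (47 / 20 + 1 / 200) * (47 / 20 + 1 / 200).
    by apply: ler_pM; clear -x0 xE2 hEt; lra.
  by rewrite -expr2 x2; clear -q1 rho4 r2_gt; lra.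
have rho2 : rho < 19 / 10 by apply: rho_lt; clear -hr; lra.
have : (47 / 20 - 1 / 200) * (47 / 20 - 1 / 200) <= x * x.
  by apply: ler_pM; clear -xE1 hEt; lra.
have := mulr_ge0 (sqr_ge0 q) (sqr_ge0 (1 + rho)).
by rewrite -[x * x]expr2 x2; clear -rho2 rt; lra.
Qed.

(** If |s| is not much below the threshold t, the errors e_i are small compared
    with s, so that the mean of the g_i is close to 1/s; hence s + 1/s is nearly
    - z and [no_intermediate_modulus] restores the full bound t <= |s|. The
    remaining conclusion bounds g_i = 1 / (s + e_i). *)
Lemma self_consistent_stability n (g e : 'I_n -> C) (s : C) (E eta t : R) :
  (0 < n)%N -> 0 < eta ->
  s = - Complex E eta - mean predT g ->
  0 <= Im (mean predT g) ->
  (forall i, g i * (s + e i) = 1) ->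
  (forall i, modulus (e i) <= 1 / 1000) ->
  (t = 1 / 2 /\ `|E| <= 47 / 20) \/ (t = 3 / 4 /\ 47 / 20 <= `|E|) ->
  t - 1 / 50 <= modulus s ->
  t <= modulus s /\ forall i, modulus (g i) <= 21 / 10.
Proof.
move=> n0 eta0 sE m0 ge1 e_le ht hs.
have r_ge : 48 / 100 <= modulus s by case: ht => -[tE _]; rewrite tE in hs; lra.
have s0 : s != 0.
  by apply/eqP => s0; move: r_ge; rewrite s0 Normc.normc0; lra.
have g_le i : modulus (g i) <= 21 / 10.
  have : 479 / 1000 <= modulus (s + e i).
    have := modulusD (s + e i) (- e i); rewrite addrK modulusN.
    by move: (e_le i) r_ge; clear; lra.
  have := ge1 i => /(congr1 modulus); rewrite Normc.normcM Normc.normc1.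
  have := modulus_ge0 (g i); move: (modulus (g i)) (modulus _) => a b; nra.
split => //.
have ms : modulus (mean predT g - s^-1) <= 1 / 200.
  rewrite -[X in _ - X](mean_cst n)// -meanB; apply: modulus_mean_le => // i.
  have -> : g i - s^-1 = - (e i * g i * s^-1).
    have -> : e i * g i = 1 - g i * s by rewrite -(ge1 i); ring.
    by rewrite mulrBl mulfK// mul1r opprB.
  rewrite modulusN !Normc.normcM Normc.normcV.
  rewrite ler_pdivrMr; last by lra.
  have := e_le i; have := g_le i; have := modulus_ge0 (e i).
  have := modulus_ge0 (g i).
  move: (modulus (g i)) (modulus (e i)) (modulus s) r_ge => a b r; nra.
have Ims : Im s <= 0 by rewrite sE Im_add !Im_opp /=; lra.
pose rho := (modulus s ^+ 2)^-1.
have r2 : rho * modulus s ^+ 2 = 1 by rewrite mulVf// sqrf_eq0; lra.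
have sVE : s^-1 = Complex (Re s * rho) (- (Im s * rho)).
  apply: (mulfI s0); rewrite mulfV//; apply/eqP; rewrite eq_complex.
  rewrite Re_mul Im_mul /=; apply/andP; split; apply/eqP; last by ring.
  by rewrite -r2 sqr_modulus; ring.
have bnd : modulus (Complex E eta + s + s^-1) <= 1 / 200.
  rewrite -modulusN; congr (_ <= _) : ms; congr (modulus _); rewrite sE; ring.
have t0 : 0 <= t by case: ht => -[-> _]; lra.
rewrite -(@ler_pXn2r _ 2)// ?nnegrE ?modulus_ge0// sqr_modulus.
apply: (@no_intermediate_modulus E eta (Re s) (Im s) rho) => //.
- by rewrite -sqr_modulus.
- apply: le_trans bnd.
  have -> : E + Re s * (1 + rho) = Re (Complex E eta + s + s^-1).
    by rewrite sVE !Re_add /=; ring.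
  rewrite ler_norml modulus_geRe andbT lerNl -Re_opp -modulusN; exact: modulus_geRe.
- apply: le_trans bnd.
  have -> : eta + Im s * (1 - rho) = Im (Complex E eta + s + s^-1).
    by rewrite sVE !Im_add /=; ring.
  rewrite ler_norml modulus_geIm andbT lerNl -Im_opp -modulusN; exact: modulus_geIm.
- rewrite -sqr_modulus ler_pXn2r// nnegrE ?modulus_ge0//.
  by case: ht => -[-> _]; lra.
Qed.

Definition stieltjes {n} (A : 'M[R]_n) (z : C) : C :=
  mean predT (fun j => resolvent A z j j).

Definition minor_stieltjes {n} (A : 'M[R]_n) (i : 'I_n) (z : C) : C :=
  mean (fun j => j != i) (fun j => resolvent (zero_cross A i) z j j).

Definition fluctuation {n} (A : 'M[R]_n) (i : 'I_n) (z : C) : C :=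
  \sum_(j | j != i) \sum_(k | k != i)
    resolvent (zero_cross A i) z j k * (A i j)%:C%C * (A i k)%:C%C
  - minor_stieltjes A i z.

(** Descending induction on the height eta0 + k h. At the top height, which is
    at least 3, the resolvent is at most 1/3 and |s| >= 3. A step of size h
    changes m by at most 1/100, so the estimates at the previous height put s
    and m within reach of [self_consistent_stability]. *)
Lemma local_law n (A : 'M[R]_n) (E eta0 h : R) (L : nat) :
  (0 < n)%N -> (forall i j, A i j = A j i) ->
  (forall i, `|A i i| <= 1 / 4000) ->
  0 < eta0 -> 4000 <= n%:R * eta0 ->
  0 <= h -> h <= eta0 ^+ 2 / 100 -> h <= 1 / 100 -> 3 <= eta0 + L%:R * h ->
  (forall k i, (k <= L)%N ->
    modulus (fluctuation A i (Complex E (eta0 + k%:R * h))) <=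
    (1 + Im (minor_stieltjes A i (Complex E (eta0 + k%:R * h)))) / 10000) ->
  forall i, modulus (resolvent A (Complex E eta0) i i) <= 21 / 10.
Proof.
move=> n0 symA diagA eta0_gt0 eta0_ge h0 h_le h_le' top hfl.
have n0R : 0 < n%:R :> R by rewrite ltr0n.
pose eta k := eta0 + k%:R * h.
have eta_ge k : eta0 <= eta k by rewrite lerDl mulr_ge0.
have eta_gt0 k : 0 < eta k by apply: lt_le_trans (eta_ge k).
pose G k i := resolvent A (Complex E (eta k)) i i.
pose m k := stieltjes A (Complex E (eta k)).
pose s k := - Complex E (eta k) - m k.
have Imm k : 0 <= Im (m k).
  rewrite Im_mean mulr_ge0 ?invr_ge0 ?ler0n//.
  by apply: sumr_ge0 => i _; exact: Im_resolvent_ge0.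
have nG k i : modulus (G k i) <= (eta k)^-1.
  by rewrite -[leRHS]mul1r ler_pdivlMr// mulrC; apply: resolvent_diag_le.
(* The threshold depends on E only, so it is the same at all heights. *)
pose t : R := if `|E| <= 47 / 20 then 1 / 2 else 3 / 4.
have ht : (t = 1 / 2 /\ `|E| <= 47 / 20) \/ (t = 3 / 4 /\ 47 / 20 <= `|E|).
  by rewrite /t; case: leP => hE; [left|right]; split=> //; exact: ltW.
have t34 : t <= 3 / 4 by case: ht => -[-> _]; clear; lra.
have step k : (k <= L)%N -> modulus (m k) <= 22 / 10 -> t - 1 / 50 <= modulus (s k) ->
    t <= modulus (s k) /\ forall i, modulus (G k i) <= 21 / 10.
  move=> kL mk sk.
  pose z := Complex E (eta k).
  pose e i := (A i i)%:C%C + (m k - minor_stieltjes A i z) - fluctuation A i z.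
  have dm i : modulus (m k - minor_stieltjes A i z) <= 1 / 4000.
    rewrite /m /minor_stieltjes /mean -mulrBr Normc.normcM modulus_real.
    rewrite ger0_norm ?invr_ge0 ?ler0n// mulrC ler_pdivrMr//.
    have h1 := trace_minor_le _ A E (eta k) i symA (eta_gt0 k).
    have h2 : 4000 <= n%:R * eta k by apply: le_trans eta0_ge _; rewrite ler_pM2l.
    apply: le_trans (_ : (eta k)^-1 <= _).
      by rewrite -[leRHS]mul1r ler_pdivlMr// mulrC.
    by rewrite -[leLHS]mul1r ler_pdivrMr//; clear -h2; lra.
  apply: (@self_consistent_stability n (G k) e (s k) E (eta k)) => //;
    [exact: Imm k | move=> i | move=> i].
    have := schur_complement _ A E (eta k) i symA (eta_gt0 k) => <-.
    by congr (_ * _); rewrite /s /e /fluctuation -/z; ring.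
  rewrite /e; apply: le_trans (modulusD _ _) _; rewrite modulusN.
  apply: le_trans (lerD (modulusD _ _) (lexx _)) _.
  rewrite modulus_real.
  have h1 := hfl k i kL; rewrite -/(eta k) -/z in h1.
  have h2 := modulus_geIm (minor_stieltjes A i z).
  have h3 := modulusD (m k) (- (m k - minor_stieltjes A i z)).
  rewrite modulusN opprB addrC subrK in h3.
  have := dm i; have := diagA i.
  by move: h1 h2 h3 mk; clear; lra.
have all j : (j <= L)%N -> t <= modulus (s (L - j)%N) /\ forall i, modulus (G (L - j)%N i) <= 21 / 10.
  elim: j => [_|j IH jL].
    rewrite subn0.
    have mL : modulus (m L) <= 1 / 3.
      apply: modulus_mean_le => // i; apply: le_trans (nG L i) _.
      by rewrite -[leLHS]mul1r ler_pdivrMr//; move: top; rewrite /eta; clear; lra.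
    have sL : 3 <= modulus (s L).
      apply: le_trans (modulus_geNIm _); rewrite Im_add !Im_opp /=.
      by move: top (Imm L); rewrite /eta; clear; lra.
    by apply: step => //; [clear -mL; lra | clear -sL t34; lra].
  have [sj Gj] := IH (ltnW jL).
  set k := (L - j.+1)%N; have kE : (L - j)%N = k.+1 by rewrite /k subnSK.
  rewrite kE in sj Gj.
  have etaS : eta k.+1 - eta k = h by rewrite /eta -natr1; ring.
  have dm : modulus (m k.+1 - m k) <= 1 / 100.
    rewrite /m /stieltjes -meanB; apply: modulus_mean_le => // i.
    have := @resolvent_lipschitz _ _ A E (eta k.+1) (eta k) i symA (eta_gt0 _) (eta_gt0 _).
    rewrite etaS ger0_norm// => hl.
    rewrite -(@ler_pM2l _ (eta k.+1 * eta k)) ?mulr_gt0//; apply: le_trans hl _.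
    apply: le_trans h_le _; rewrite expr2 mul1r ler_pM2r ?invr_gt0 ?ltr0n//.
    by apply: ler_pM => //; exact: ltW.
  have mk1 : modulus (m k.+1) <= 21 / 10 by apply: modulus_mean_le.
  apply: step; first by rewrite /k leq_subr.
    have := modulusD (m k.+1) (- (m k.+1 - m k)).
    by rewrite modulusN opprB addrC subrK => h1; clear -h1 dm mk1; lra.
  have sS : s k.+1 = s k - (Complex 0 h + (m k.+1 - m k)).
    rewrite /s -etaS.
    have -> : Complex 0 (eta k.+1 - eta k) = Complex E (eta k.+1) - Complex E (eta k).
      by apply/eqP; rewrite eq_complex Re_add Im_add Re_opp Im_opp /= subrr !eqxx.
    ring.
  have nh : modulus (Complex 0 h) <= 1 / 100.
    by rewrite /= expr0n add0r sqrtr_sqr ger0_norm.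
  have := modulusD (s k) (- (Complex 0 h + (m k.+1 - m k))).
  have := modulusD (Complex 0 h) (m k.+1 - m k).
  rewrite modulusN -sS => h1 h2.
  by clear -h1 h2 dm nh sj; lra.
move=> i; have := (all L (leqnn _)).2 i.
by rewrite subnn /G /eta mul0r addr0.
Qed.

End Stability.

(** * Averaging over the signs of one row *)

Section SignPatterns.
Context {R : realType} {n : nat}.
Local Notation C := R[i].
Local Notation modulus := (@Normc.normc R).
Local Notation pattern := {set 'I_n * 'I_n}.

Definition upper (i j : 'I_n) : 'I_n * 'I_n := if (i <= j)%N then (i, j) else (j, i).

Definition upper_pairs : pattern := [set p : 'I_n * 'I_n | (p.1 <= p.2)%N]%SET.

Lemma upper_sym i j : upper i j = upper j i.
Proof.
rewrite /upper; case: ltngtP => // ij.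
by have -> : i = j by apply: val_inj.
Qed.

Lemma upper_inj i : injective (upper i).
Proof.
move=> j k; rewrite /upper.
by case: leqP => ij; case: leqP => ik [] // *; subst; rewrite ?ltnn // in ij ik *.
Qed.

Lemma upper_in i j : upper i j \in upper_pairs.
Proof. by rewrite inE /upper; case: (leqP i j) => [|/ltnW]. Qed.

Lemma upper_neq (i j k l : 'I_n) : k != i -> l != i -> upper k l != upper i j.
Proof.
move=> ki li; rewrite /upper; case: leqP => _; case: leqP => _;
  by rewrite xpair_eqE ?(negPf ki) ?(negPf li) ?andbF.
Qed.

Definition sign_of (S : pattern) (i j : 'I_n) : R :=
  if upper i j \in S then 1 else -1.

Definition sign_matrix (S : pattern) : 'M[R]_n := \matrix_(i, j) sign_of S i j.

(** The normalized sign matrix whose entry in position (i, j) with i <= j is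
    positive exactly when (i, j) belongs to S; patterns are taken inside
    [upper_pairs]. *)
Definition wigner (S : pattern) : 'M[R]_n := normalized (sign_matrix S).

Lemma sign_of_sym S i j : sign_of S i j = sign_of S j i.
Proof. by rewrite /sign_of upper_sym. Qed.

Lemma wignerE S i j : wigner S i j = (Num.sqrt n%:R)^-1 * sign_of S i j.
Proof. by rewrite !mxE. Qed.

Lemma wigner_sym S i j : wigner S i j = wigner S j i.
Proof. by rewrite !wignerE sign_of_sym. Qed.

Lemma sign_of_sqr S i j : sign_of S i j ^+ 2 = 1.
Proof. by rewrite /sign_of; case: ifP; rewrite ?sqrrN expr1n. Qed.

Lemma wigner_sqr S i j : wigner S i j ^+ 2 = n%:R^-1.
Proof.
by rewrite wignerE exprMn sign_of_sqr mulr1 exprVn sqr_sqrtr.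
Qed.

Definition flip_set (i : 'I_n) (tau : 'I_n -> R) : pattern :=
  [set p : 'I_n * 'I_n | [exists j, (p == upper i j) && (tau j == -1)]]%SET.

(** Changes of sign in row i, as a set-theoretic symmetric difference, so that a
    fixed flip is visibly an involution. *)
Definition flip (i : 'I_n) (tau : 'I_n -> R) (S : pattern) : pattern :=
  [set p : 'I_n * 'I_n | (p \in S) (+) (p \in flip_set i tau)]%SET.

Lemma flipK i tau : involutive (flip i tau).
Proof. by move=> S; apply/setP => p; rewrite !inE addbK. Qed.

Lemma flip_subset i tau S : (flip i tau S \subset upper_pairs) = (S \subset upper_pairs).
Proof.
have sub (S' : pattern) : S' \subset upper_pairs -> flip i tau S' \subset upper_pairs.
  move=> /fintype.subsetP S'D; apply/fintype.subsetP => p; rewrite inE.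
  have [/S'D //|_] := boolP (p \in S').
  by rewrite inE => /existsP[j /andP[/eqP -> _]]; exact: upper_in.
by apply/idP/idP => /sub; rewrite ?flipK.
Qed.

Lemma sign_of_flip i tau S j : sign_vector tau ->
  sign_of (flip i tau S) i j = sign_of S i j * tau j.
Proof.
move=> tauP; have -> : sign_of (flip i tau S) i j =
    if (upper i j \in S) (+) (tau j == -1) then 1 else -1.
  rewrite /sign_of inE; congr (if _ (+) _ then _ else _); rewrite inE.
  apply/existsP/idP => [[k /andP[/eqP /upper_inj -> //]]|tj].
  by exists j; rewrite eqxx.
have one_neq : (1 : R) == -1 = false.
  by apply/negbTE; rewrite -subr_eq0 opprK; apply/eqP; lra.
rewrite /sign_of; case: (tauP j) => ->; rewrite ?one_neq ?eqxx ?addbF ?addbT.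
  by rewrite mulr1.
by case: (upper i j \in S); rewrite /= ?mulrNN ?mulr1 ?mul1r.
Qed.

Lemma zero_cross_flip i tau S :
  zero_cross (wigner (flip i tau S)) i = zero_cross (wigner S) i.
Proof.
apply/matrixP => j k; rewrite [LHS]mxE [RHS]mxE.
have [//|ji] := eqVneq j i; have [//|ki] := eqVneq k i; rewrite /= !wignerE.
congr (_ * _); rewrite /sign_of [in LHS]inE inE.
have -> : [exists j0, (upper j k == upper i j0) && (tau j0 == -1)] = false.
  by apply/existsP => -[l]; rewrite (negPf (upper_neq _ _ _ _ ji ki)).
by rewrite addbF.
Qed.

(** For each tau, flipping is a bijection of the patterns, so averaging over tau
    does not change the sum. In the inner average W^(i) is frozen while the
    entries of row i are multiplied by independent signs: this plays the role of
    conditioning on W^(i). *)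
Lemma sum_flip i (f : pattern -> R) :
  \sum_(S : pattern | S \subset upper_pairs) f S =
  \sum_(S : pattern | S \subset upper_pairs) sign_avg n (fun tau => f (flip i tau S)).
Proof.
rewrite -sign_avg_sum -[LHS](sign_avg_cst n); apply: sign_avg_eq => tau _.
rewrite (reindex_inj (inv_inj (flipK i tau))) /=.
by apply: eq_bigl => S; rewrite flip_subset.
Qed.

Section Fluctuation.
Variables (i : 'I_n) (E eta : R) (c : C).
Hypotheses (eta0 : 0 < eta) (c1 : modulus c = 1).
Local Notation z := (Complex E eta).
Local Notation G0 S := (resolvent (zero_cross (wigner S) i) z).

Let N S (j k : 'I_n) : R :=
  Re (c * G0 S j k) * ((j != i)%:R * wigner S i j) * ((k != i)%:R * wigner S i k).

Let n_gt0 : 0 < n%:R :> R.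
Proof. by rewrite ltr0n; case: (n) i => [|//] []. Qed.

Let N_il S k : N S i k = 0. Proof. by rewrite /N eqxx /=; ring. Qed.
Let N_ir S k : N S k i = 0. Proof. by rewrite /N eqxx /=; ring. Qed.

Lemma fluctuation_flip tau S : sign_vector tau ->
  Re (c * fluctuation (wigner (flip i tau S)) i z) =
  qform (N S) tau - Re (c * minor_stieltjes (wigner S) i z).
Proof.
move=> tauP; rewrite /fluctuation /minor_stieltjes zero_cross_flip.
rewrite mulrBr Re_add Re_opp; congr (_ - _).
rewrite mulr_sumr Re_sum [RHS](bigD1 i)//= [X in _ = X + _]big1 ?add0r; last first.
  by move=> k _; rewrite N_il !mul0r.
apply: eq_bigr => j ji; rewrite mulr_sumr Re_sum.
rewrite [RHS](bigD1 i)//= N_ir !mul0r add0r.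
apply: eq_bigr => k ki; rewrite /N ji ki !mulr1n !mul1r !wignerE !sign_of_flip//.
by rewrite !mulrA !(Re_mul _ (_%:C)%C) /=; ring.
Qed.

Lemma trace_N S : \sum_j N S j j = Re (c * minor_stieltjes (wigner S) i z).
Proof.
rewrite /minor_stieltjes /mean mulrCA Re_mul /= mul0r subr0 mulr_sumr Re_sum mulr_sumr.
rewrite (bigD1 i)//= N_il add0r; apply: eq_bigr => j ji.
by rewrite /N ji !mulr1n !mul1r -mulrA -expr2 wigner_sqr mulrC.
Qed.

Lemma Re_phase_le (x : C) : `|Re (c * x)| <= modulus x.
Proof.
have -> : modulus x = modulus (c * x) by rewrite Normc.normcM c1 mul1r.
by rewrite ler_norml modulus_geRe andbT lerNl -Re_opp -modulusN modulus_geRe.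
Qed.

(** Ward's identity for the minor: n^-2 sum_j |G0_jk|^2 = n^-2 Im G0_kk / eta,
    summed over k. *)
Lemma fro2_N S : fro2 (N S) <= Im (minor_stieltjes (wigner S) i z) / (n%:R * eta).
Proof.
rewrite /minor_stieltjes Im_mean /fro2 exchange_big /=.
rewrite (bigD1 i)//= big1 ?add0r; last first.
  by move=> j _; rewrite N_ir expr0n.
have -> : n%:R^-1 * (\sum_(k | k != i) Im (G0 S k k)) / (n%:R * eta) =
    \sum_(k | k != i) \sum_j n%:R^-1 ^+ 2 * modulus (G0 S j k) ^+ 2.
  rewrite mulr_sumr mulr_suml; apply: eq_bigr => k ki.
  rewrite ward//; last exact: (zero_cross_sym _ _ _ (wigner_sym S)).
  by rewrite -mulr_sumr; field; rewrite !gt_eqF.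
apply: ler_sum => k ki; apply: ler_sum => j _.
have bool_le (b : bool) : 0 <= (b%:R ^+ 2 * n%:R^-1 : R) <= n%:R^-1.
  by case: b => /=; rewrite ?expr1n ?expr0n/= ?mul1r ?mul0r ?lexx ?invr_ge0 ?ler0n.
rewrite /N !exprMn !wigner_sqr -mulrA [leRHS]mulrC.
have /andP[b0 b1] := bool_le (j != i); have /andP[b2 b3] := bool_le (k != i).
apply: ler_pM; [exact: sqr_ge0 | exact: mulr_ge0 | | by rewrite expr2; exact: ler_pM].
rewrite -(real_normK (num_real (Re _))) ler_pXn2r ?nnegrE ?modulus_ge0//.
exact: Re_phase_le.
Qed.

Lemma qform_N_le S v : `|qform (N S) v| <= (n%:R * eta)^-1 * dotp v v.
Proof.
pose x j := (j != i)%:R * wigner S i j * v j.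
have -> : qform (N S) v = Re (c * \sum_j \sum_k G0 S j k * (x j)%:C%C * (x k)%:C%C).
  rewrite mulr_sumr Re_sum; apply: eq_bigr => j _.
  rewrite mulr_sumr Re_sum; apply: eq_bigr => k _.
  by rewrite !mulrA !(Re_mul _ (_%:C)%C) /= /N /x; ring.
apply: le_trans (Re_phase_le _) _.
have h := resolvent_form_le _ (zero_cross (wigner S) i) E eta
  (zero_cross_sym _ _ _ (wigner_sym S)) eta0 x.
have hx : dotp x x <= n%:R^-1 * dotp v v.
  rewrite /dotp mulr_sumr; apply: ler_sum => j _.
  rewrite -!expr2 /x !exprMn wigner_sqr -mulrA -[leRHS]mul1r.
  apply: ler_wpM2r; first by rewrite mulr_ge0 ?invr_ge0 ?ler0n ?sqr_ge0.
  by case: (j != i); rewrite /= ?expr0n ?expr1n.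
rewrite invfM -mulrA mulrCA -ler_pdivrMl ?invr_gt0// invrK.
exact: le_trans h hx.
Qed.

(** Exponential Markov inequality with theta = alpha n eta / 16, the largest
    value that [hanson_wright_mgf] allows up to the factor alpha. The term 8
    theta^2 |N|_F^2 is at most half of theta alpha Im m^(i), which is why the
    threshold contains Im m^(i). *)
Lemma fluctuation_tail (alpha : R) : 0 < alpha -> alpha <= 1 ->
  #|[set S : {set 'I_n * 'I_n} | (S \subset upper_pairs) &&
     (alpha * (1 + Im (minor_stieltjes (wigner S) i z))
        < Re (c * fluctuation (wigner S) i z))]%SET|%:R
  <= 2 ^+ #|upper_pairs| * expR (- (alpha ^+ 2 * (n%:R * eta) / 16)).
Proof.
move=> a0 a1; pose theta := alpha * (n%:R * eta) / 16.
have ne0 : 0 < n%:R * eta by rewrite mulr_gt0.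
have th0 : 0 <= theta by apply: divr_ge0 => //; apply: mulr_ge0; exact: ltW.
pose T S := alpha * (1 + Im (minor_stieltjes (wigner S) i z)).
(* f is at least 1 on the exceptional patterns. *)
pose f S := expR (theta * (Re (c * fluctuation (wigner S) i z) - T S)).
apply: le_trans (_ : \sum_(S : pattern | S \subset upper_pairs) f S <= _).
  rewrite -sum1_card natr_sum.
  rewrite (eq_bigl (fun S : pattern => (S \subset upper_pairs) &&
    (T S < Re (c * fluctuation (wigner S) i z)))); last by move=> S; rewrite inE.
  rewrite big_mkcondr /=; apply: ler_sum => S _; case: ifP => [h|_]; last exact: expR_ge0.
  by rewrite -expR0 ler_expR mulr_ge0 ?subr_ge0 ?(ltW h).
rewrite (sum_flip i).
have -> : 2 ^+ #|upper_pairs| = \sum_(S : pattern | S \subset upper_pairs) (1 : R).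
  rewrite sumr_const -natrX -card_powerset; congr (_%:R).
  by apply: eq_card => S; rewrite powersetE.
rewrite mulr_suml; apply: ler_sum => S _; rewrite mul1r.
have -> : sign_avg n (fun tau => f (flip i tau S)) =
    expR (- (theta * (Re (c * minor_stieltjes (wigner S) i z) + T S))) *
    sign_avg n (fun tau => expR (theta * qform (N S) tau)).
  rewrite -sign_avgZ; apply: sign_avg_eq => tau tauP.
  rewrite /f fluctuation_flip// -expRD; congr expR.
  by rewrite /T /minor_stieltjes zero_cross_flip; ring.
have symN j k : N S j k = N S k j.
  rewrite /N resolvent_sym; first by ring.
  exact: (zero_cross_sym _ _ _ (wigner_sym S)).
have := hanson_wright_mgf _ (N S) (n%:R * eta)^-1 theta symN _ th0 _ (qform_N_le S).
rewrite invr_gt0 => /(_ ne0); rewrite trace_N => hw.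
apply: le_trans (ler_wpM2l (expR_ge0 _) (hw _)) _.
  rewrite ler_pdivrMr// mul1r /theta.
  have : alpha * (n%:R * eta) <= 1 * (n%:R * eta) by rewrite ler_pM2r.
  lra.
rewrite -expRD ler_expR.
set m := minor_stieltjes _ _ _.
have m0 : 0 <= Im m.
  rewrite /m Im_mean mulr_ge0 ?invr_ge0 ?ler0n//; apply: sumr_ge0 => j _.
  by apply: Im_resolvent_ge0 => //; exact: (zero_cross_sym _ _ _ (wigner_sym S)).
have h1 : 8 * theta ^+ 2 * fro2 (N S) <= alpha ^+ 2 * (n%:R * eta) / 32 * Im m.
  apply: le_trans (ler_wpM2l _ (fro2_N S)) _; first by rewrite mulr_ge0 ?sqr_ge0.
  rewrite -/m le_eqVlt; apply/orP; left; apply/eqP; rewrite /theta.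
  by field; rewrite !gt_eqF.
have h2 : 0 <= alpha ^+ 2 * (n%:R * eta) * Im m.
  by apply: mulr_ge0 => //; apply: mulr_ge0; [exact: sqr_ge0 | exact: ltW].
rewrite /T -/m; move: (Re _) (8 * _ * _) h1 => x F h1.
have -> : - (theta * (x + alpha * (1 + Im m))) + (theta * x + F) =
    F - alpha * theta - alpha * theta * Im m by ring.
have -> : alpha * theta = alpha ^+ 2 * (n%:R * eta) / 16 by rewrite /theta; ring.
lra.
Qed.

End Fluctuation.
End SignPatterns.
Arguments upper_pairs : clear implicits.

(** * Simultaneous control of all fluctuations and its consequences *)

Section Concentration.
Context {R : realType} (n : nat).
Local Notation C := R[i].
Local Notation modulus := (@Normc.normc R).
Local Notation pattern := {set 'I_n * 'I_n}.
Variables (J L : nat) (energy : nat -> R) (eta0 h alpha : R).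

Definition event_index : finType := ('I_n * 'I_J * 'I_L.+1 * 'I_4)%type.

(** The four powers of i: upper bounds on Re (i^q x) for q < 4 bound both |Re x|
    and |Im x|. *)
Definition phase (q : nat) : C := Complex 0 1 ^+ q.

Definition concentrated_at (u : event_index) (S : pattern) : bool :=
  let: (i, j, k, q) := u in
  let z := Complex (energy j) (eta0 + k%:R * h) in
  Re (phase q * fluctuation (wigner S) i z)
    <= alpha * (1 + Im (minor_stieltjes (wigner S) i z)).

Definition concentrated (S : pattern) : bool := [forall u, concentrated_at u S].

Lemma modulus_phase q : modulus (phase q) = 1.
Proof.
rewrite /phase; elim: q => [|q IH]; first by rewrite expr0 Normc.normc1.
by rewrite exprS Normc.normcM IH mulr1 /= expr0n expr1n add0r sqrtr1.
Qed.

Lemma card_union_bound (T I : finType) (D : {pred T}) (P : I -> {pred T}) :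
  (#|[set S : T | (S \in D) && ~~ [forall u, P u S]]%SET|
   <= \sum_u #|[set S : T | (S \in D) && ~~ P u S]%SET|)%N.
Proof.
rewrite -sum1_card; under [leqRHS]eq_bigr do rewrite -sum1_card.
rewrite (exchange_big_dep predT)//= big_mkcond /=; apply: leq_sum => S _.
case: ifP => //; rewrite inE => /andP[SD /forallPn[u Pu]].
by rewrite (bigD1 u)//= inE SD Pu.
Qed.

Lemma few_unconcentrated_patterns : 0 < eta0 -> 0 <= h -> 0 < alpha -> alpha <= 1 ->
  #|[set S : pattern | (S \subset upper_pairs n) && ~~ concentrated S]%SET|%:R
  <= (n * J * L.+1 * 4)%:R *
     (2 ^+ #|upper_pairs n| * expR (- (alpha ^+ 2 * (n%:R * eta0) / 16))) :> R.
Proof.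
move=> e0 h0 a0 a1.
apply: le_trans (_ : (\sum_(u : event_index) #|[set S : pattern |
    (S \subset upper_pairs n) && ~~ concentrated_at u S]%SET|)%N%:R <= _).
  by rewrite ler_nat; apply: (card_union_bound _ _ (fun S : pattern => S \subset upper_pairs n)).
have -> : (n * J * L.+1 * 4)%N = #|{: event_index}|.
  by rewrite !card_prod !card_ord.
rewrite natr_sum -[#|{: event_index}|]sum1_card natr_sum mulr_suml; apply: ler_sum => -[[[i j] k] q] _.
rewrite mul1r.
pose eta := eta0 + k%:R * h.
have e_ge : eta0 <= eta by rewrite lerDl mulr_ge0.
have eta_gt0 : 0 < eta by apply: lt_le_trans e_ge.
apply: le_trans (_ : 2 ^+ #|upper_pairs n| * expR (- (alpha ^+ 2 * (n%:R * eta) / 16)) <= _).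
  apply: le_trans (fluctuation_tail i (energy j) eta _ eta_gt0 (modulus_phase q) alpha a0 a1).
  by rewrite ler_nat; apply: subset_leq_card; apply/fintype.subsetP => S; rewrite !inE /= ltNge.
rewrite ler_wpM2l ?exprn_ge0// ler_expR lerN2 ler_pM2r// ler_wpM2l ?sqr_ge0//.
by rewrite ler_wpM2l.
Qed.

Lemma concentrated_fluctuation S i j k : concentrated S -> (j < J)%N -> (k <= L)%N ->
  modulus (fluctuation (wigner S) i (Complex (energy j) (eta0 + k%:R * h))) <=
  2 * alpha * (1 + Im (minor_stieltjes (wigner S) i (Complex (energy j) (eta0 + k%:R * h)))).
Proof.
move=> /forallP cS jJ kL; set z := Complex _ _.
have hq q : Re (phase q%N * fluctuation (wigner S) i z)
    <= alpha * (1 + Im (minor_stieltjes (wigner S) i z)) \/ (4 <= q)%N.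
  case: (ltnP q 4) => q4; last by right.
  by left; have := cS (i, Ordinal jJ, Ordinal (kL : k < L.+1)%N, Ordinal q4).
have -> : 2 * alpha * (1 + Im (minor_stieltjes (wigner S) i z)) =
  alpha * (1 + Im (minor_stieltjes (wigner S) i z)) +
  alpha * (1 + Im (minor_stieltjes (wigner S) i z)) by ring.
have [h0|//] := hq 0; have [h1|//] := hq 1; have [h2|//] := hq 2; have [h3|//] := hq 3.
apply: le_trans (modulus_le _) _.
move: h0 h1 h2 h3; rewrite /phase; case: (fluctuation _ _ _) => a b.
rewrite !exprS expr0 !Re_mul !Im_mul /= => h0 h1 h2 h3.
apply: lerD; rewrite ler_norml; apply/andP; split; lra.
Qed.

End Concentration.

Section Delocalization.
Context {R : realType} (n : nat).
Local Notation pattern := {set 'I_n * 'I_n}.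

Definition grid_energy (j : nat) : R := j%:R / n%:R - n%:R.

(** Twice this level bounds the fluctuation by (1 + Im m^(i)) / 10000, as
    [local_law] requires. *)
Definition noise_level : R := 1 / 20000.

(** Eigenvalues lie in [-sqrt n, sqrt n], which is inside [-n, n]; the grid has
    spacing 1/n there, below the scale eta of interest. *)
Lemma grid_approx (lam : R) : (0 < n)%N -> lam ^+ 2 <= n%:R ->
  exists2 j, (j < (2 * n * n).+1)%N & `|lam - grid_energy j| <= n%:R^-1.
Proof.
move=> n0 lam2; have n0R : 0 < n%:R :> R by rewrite ltr0n.
have n1R : 1 <= n%:R :> R by rewrite ler1n.
have : `|lam| <= n%:R.
  rewrite -(@ler_pXn2r _ 2)// ?nnegrE// real_normK ?num_real//.
  by apply: le_trans lam2 _; rewrite expr2 -[leLHS]mul1r ler_pM2r.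
rewrite ler_norml => /andP[l1 l2].
have x0 : 0 <= (lam + n%:R) * n%:R by apply: mulr_ge0 => //; lra.
exists (Num.truncn ((lam + n%:R) * n%:R)).
  rewrite ltnS -(ler_nat R).
  have /andP[tl _] := truncn_itv x0; apply: le_trans tl _.
  by rewrite !natrM ler_pM2r//; lra.
have /andP[tl tu] := truncn_itv x0.
set j := Num.truncn _ in tl tu *.
have -> : lam - grid_energy j = ((lam + n%:R) * n%:R - j%:R) / n%:R.
  by rewrite /grid_energy mulrBl mulfK ?gt_eqF//; ring.
rewrite normrM normfV [`|n%:R|]ger0_norm// -[leRHS]mul1r ler_pM2r ?invr_gt0//.
by move: tu; rewrite -natr1 ler_norml => tu; apply/andP; split; lra.
Qed.

(** The squared Frobenius norm of the matrix is n^2 / n. *)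
Lemma eigenvalue_sqr_le (S : pattern) (u : 'I_n -> R) (lam : R) : (0 < n)%N ->
  (forall i, \sum_j wigner S i j * u j = lam * u i) -> \sum_j u j ^+ 2 = 1 ->
  lam ^+ 2 <= n%:R.
Proof.
move=> n0 Su u1; have n0R : n%:R != 0 :> R by rewrite pnatr_eq0 -lt0n.
rewrite -[leLHS]mulr1 -[in leLHS]u1 mulr_sumr.
apply: le_trans (_ : \sum_(i < n) (1 : R) <= _); last first.
  by rewrite sumr_const card_ord.
apply: ler_sum => i _; rewrite -exprMn -Su.
apply: le_trans (cauchy_schwarz _ _ _) _; rewrite u1 mulr1.
under eq_bigr do rewrite wigner_sqr.
by rewrite sumr_const card_ord -[leLHS]mulr_natl mulfV.
Qed.

(** The choices L = n^2 and h = eta0^2 / 100 make the descent start at height at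
    least 3, because n eta0 >= 4000. *)
Lemma concentrated_delocalized (eta0 : R) (S : pattern) (u : 'I_n -> R) (lam : R) i :
  (0 < n)%N -> 0 < eta0 -> eta0 <= 1 -> 4000 <= n%:R * eta0 ->
  (Num.sqrt n%:R)^-1 <= 1 / 4000 :> R ->
  concentrated n (2 * n * n).+1 (n * n) grid_energy eta0 (eta0 ^+ 2 / 100) noise_level S ->
  (forall i, \sum_j wigner S i j * u j = lam * u i) -> \sum_j u j ^+ 2 = 1 ->
  u i ^+ 2 <= 42 / 10 * eta0.
Proof.
move=> n0 e0 e1 ne nsqrt cS Su u1.
have n0R : 0 < n%:R :> R by rewrite ltr0n.
have [j jJ lj] := grid_approx lam n0 (eigenvalue_sqr_le _ _ _ n0 Su u1).
have e2 : 0 <= eta0 ^+ 2 by exact: sqr_ge0.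
have e2' : eta0 ^+ 2 <= 1 by rewrite expr_le1// ltW.
have G21 : Normc.normc (resolvent (wigner S) (Complex (grid_energy j) eta0) i i) <= 21 / 10.
  apply: (@local_law _ n (wigner S) (grid_energy j) eta0 (eta0 ^+ 2 / 100) (n * n)%N n0 _ _ e0 ne).
  - by move=> k l; exact: wigner_sym.
  - move=> k; rewrite wignerE normrM normfV (ger0_norm (sqrtr_ge0 _)).
    by rewrite /sign_of; case: ifP => _; rewrite ?normrN normr1 mulr1.
  - by clear -e2; lra.
  - exact: lexx.
  - by clear -e2'; lra.
  - have : 4000 * 4000 <= (n%:R * eta0) * (n%:R * eta0).
      by apply: ler_pM; [exact: ler0n | exact: ler0n | exact: ne | exact: ne].
    rewrite natrM; have -> : n%:R * eta0 * (n%:R * eta0) = n%:R * n%:R * eta0 ^+ 2 by ring.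
    by move=> hne; clear -hne e0; lra.
  - move=> k l kL; apply: le_trans (concentrated_fluctuation _ _ _ _ _ _ _ _ _ _ _ cS jJ kL) _.
    by rewrite /noise_level; clear; lra.
have := eigenvector_entry_le _ _ (grid_energy j) eta0 (wigner_sym S) e0 u lam i Su u1.
have ImG : Im (resolvent (wigner S) (Complex (grid_energy j) eta0) i i) <= 21 / 10.
  by apply: le_trans (modulus_geIm _) G21.
have ImG0 := Im_resolvent_ge0 _ (wigner S) (grid_energy j) eta0 (wigner_sym S) e0 i.
have d2 : (lam - grid_energy j) ^+ 2 <= eta0 ^+ 2.
  rewrite -(real_normK (num_real (lam - _))) ler_pXn2r ?nnegrE ?(ltW e0)//.
  apply: le_trans lj _; rewrite -[leLHS]mul1r ler_pdivrMr// mulrC.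
  by clear -ne; lra.
move=> he; rewrite -(ler_pM2l e0); apply: le_trans he _.
apply: le_trans (_ : (2 * eta0 ^+ 2) * (21 / 10) <= _).
  apply: ler_pM => //; first by rewrite addr_ge0 ?sqr_ge0.
  by clear -d2; lra.
by rewrite expr2; clear; lra.
Qed.

End Delocalization.

Section Probability.
Context {R : realType} d (T : measurableType d) (P : probability T R).
Context (n : nat) (x : 'I_n -> 'I_n -> {RV P >-> R}).
Hypothesis hx : symmetric_rademacher x.
Local Notation pattern := {set 'I_n * 'I_n}.

Definition atom (S : pattern) : set T :=
  \bigcap_(p in [set` upper_pairs n])
     (x p.1 p.2 @^-1` [set if p \in S then (1 : R) else -1]).

Lemma measurable_atom S : measurable (atom S).
Proof.
apply: fin_bigcap_measurable; first exact: finite_finset.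
by move=> p _; apply: measurable_funPTI; exact: measurable_set1.
Qed.

(** The product rule over the whole family of entries on and above the diagonal. *)
Lemma atom_probability S : P (atom S) = (2^-1 ^+ #|upper_pairs n|)%:E.
Proof.
have [_ rad indep] := hx.
rewrite /atom (indep (upper_pairs n) (fun p => [set if p \in S then (1 : R) else -1]))//.
  rewrite (eq_bigr (fun=> (2^-1)%:E)); first by rewrite prodEFin prodr_const.
  move=> p; rewrite inE => /rad [h1 h2].
  by case: ifP.
Qed.

Lemma atom_matrix S w : atom S w -> random_matrix x w = sign_matrix S.
Proof.
have [sym _ _] := hx.
move=> aw; apply/matrixP => i j; rewrite !mxE.
have h (k l : 'I_n) : (k <= l)%N -> x k l w = sign_of S k l.
  by move=> kl; have := aw (k, l); rewrite /= inE /sign_of /upper kl; exact.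
have [/h //|/ltnW/h ji] := leqP i j.
by rewrite sym sign_of_sym.
Qed.

Lemma atom_disjoint (S S' : pattern) w : S \subset upper_pairs n -> S' \subset upper_pairs n ->
  atom S w -> atom S' w -> S = S'.
Proof.
move=> /fintype.subsetP SD /fintype.subsetP SD' aS aS'; apply/setP => p.
have [pD|pD] := boolP (p \in upper_pairs n); last first.
  by rewrite (contraNF (SD p) pD) (contraNF (SD' p) pD).
have := aS p pD; have := aS' p pD; rewrite /= => ->.
have : (1 : R) <> -1 by lra.
by case: (p \in S); case: (p \in S') => // h /esym.
Qed.

(** The atoms are disjoint and each has probability 2^-D, D being the number of
    independent entries, so probabilities are proportions of patterns. *)
Lemma sign_matrix_probability (Q : pattern -> bool) (delta : R) :
  #|[set S : pattern | (S \subset upper_pairs n) && ~~ Q S]%SET|%:R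
    <= 2 ^+ #|upper_pairs n| * delta ->
  with_probability_at_least P (1 - delta)
    [set w | exists2 S, Q S & random_matrix x w = sign_matrix S].
Proof.
move=> hQ; set D := upper_pairs n.
pose Qs := [set S : pattern | (S \subset D) && Q S]%SET.
exists (\bigcup_(S in [set` Qs]) atom S); split.
- apply: fin_bigcup_measurable; first exact: finite_finset.
  by move=> S _; exact: measurable_atom.
- move=> w [S /=]; rewrite inE => /andP[_ QS] aw; exists S => //.
  exact: atom_matrix.
rewrite measure_fin_bigcup; last 3 first.
- exact: finite_finset.
- move=> S S' /=; rewrite !inE => /andP[SD _] /andP[SD' _] [w [aS aS']].
  exact: (atom_disjoint _ _ w).
- by move=> S _; exact: measurable_atom.
have -> : [set` Qs] = [set` enum Qs].
  by apply/seteqP; split => S /=; rewrite mem_enum.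
rewrite -fsbig_seq ?enum_uniq//.
rewrite (eq_bigr (fun=> (2^-1 ^+ #|D|)%:E)); last by move=> S _; exact: atom_probability.
rewrite sumEFin lee_fin big_enum /= sumr_const -[leRHS]mulr_natl.
have two0 : 0 < 2 ^+ #|D| :> R by rewrite exprn_gt0.
have cardE : #|Qs|%:R = 2 ^+ #|D| - #|[set S : pattern | (S \subset D) && ~~ Q S]%SET|%:R :> R.
  rewrite -natrX -card_powerset; apply/eqP; rewrite eq_sym subr_eq -natrD; apply/eqP; congr (_%:R).
  rewrite -(cardsID [set S | Q S]%SET); congr (_ + _)%N; apply: eq_card => S;
    by rewrite !inE // andbC.
rewrite exprVn ler_pdivlMr// mulrBl mul1r cardE.
by apply: lerB => //; rewrite mulrC.
Qed.

End Probability.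

Lemma unit_eigenvector_exists (R : realType) n (A : 'M[R]_n) (l : 'I_n -> R) i :
  (forall i j, A i j = A j i) -> eigenvalue_list A l ->
  exists u, unit_eigenvector A (l i) u.
Proof.
move=> symA hl.
have : root (char_poly A) (l i).
  by rewrite rootE hl horner_prod (bigD1 i)//= hornerXsubC subrr mul0r.
rewrite -eigenvalue_root_char => /eigenvalueP[v vA v0].
pose s := \sum_(j < n) v 0 j ^+ 2.
have s0 : 0 < s.
  rewrite lt_neqAle sumr_ge0 ?andbT; last by move=> j _; exact: sqr_ge0.
  rewrite eq_sym; apply: contra v0; rewrite psumr_eq0; last by move=> j _; exact: sqr_ge0.
  move=> /allP h; apply/eqP/rowP => j; rewrite mxE.
  by have := h j (mem_index_enum _); rewrite sqrf_eq0 => /eqP.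
exists ((Num.sqrt s)^-1 *: v^T); split.
  rewrite -scalemxAr; have -> : A *m v^T = (v *m A)^T.
    rewrite trmx_mul; congr (_ *m _); apply/matrixP => j k; by rewrite mxE symA.
  by rewrite vA linearZ /= !scalerA mulrC.
rewrite /norm2 (eq_bigr (fun j => s^-1 * v 0 j ^+ 2)).
  by rewrite -mulr_sumr mulVf ?sqrtr1 ?gt_eqF.
by move=> j _; rewrite !mxE exprMn exprVn sqr_sqrtr ?ltW.
Qed.

(** The constant K in eta = K log n / n, for which the failure probability of
    each event at one point of the grid is at most n^-(C1 + 7). *)
Definition scale_factor (R : realType) (C1 : R) : R := 16 * (C1 + 7) / noise_level ^+ 2.

(** The union bound has at most n (2 n^2 + 1) (n^2 + 1) 4 <= n^7 events, each of
    probability at most n^-(C1 + 7). *)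
Lemma wigner_delocalization (R : realType) d (T : measurableType d)
    (P : probability T R) n (x : 'I_n -> 'I_n -> {RV P >-> R}) (C1 : R) :
  symmetric_rademacher x -> 0 < C1 -> (5 <= n)%N ->
  let eta0 := scale_factor R C1 * ln n%:R / n%:R in
  0 < eta0 -> eta0 <= 1 -> 4000 <= n%:R * eta0 ->
  (Num.sqrt n%:R)^-1 <= 1 / 4000 :> R ->
  with_probability_at_least P (1 - n%:R `^ (- C1))
    [set w | forall l, eigenvalue_list (normalized (random_matrix x w)) l ->
       forall i, exists u, unit_eigenvector (normalized (random_matrix x w)) (l i) u /\
         forall j, u j 0 ^+ 2 <= 42 / 10 * eta0].
Proof.
move=> hx C10 n5 eta0 e0 e1 ne nsqrt.
have n0 : (0 < n)%N by apply: leq_trans n5.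
have n0R : 0 < n%:R :> R by rewrite ltr0n.
have al0 : 0 < noise_level :> R by rewrite /noise_level; clear; lra.
have al1 : noise_level <= 1 :> R by rewrite /noise_level; clear; lra.
pose Q := concentrated n (2 * n * n).+1 (n * n) (grid_energy n) eta0 (eta0 ^+ 2 / 100) noise_level.
have [|A [mA AE PA]] := sign_matrix_probability _ _ P n x hx Q (n%:R `^ (- C1)).
  have h0 : 0 <= eta0 ^+ 2 / 100 by rewrite divr_ge0 ?sqr_ge0.
  apply: le_trans (few_unconcentrated_patterns _ _ _ _ _ _ _ e0 h0 al0 al1) _.
  rewrite mulrCA ler_pM2l ?exprn_gt0//.
  have -> : noise_level ^+ 2 * (n%:R * eta0) / 16 = (C1 + 7) * ln n%:R.
    by rewrite /eta0 /scale_factor; field; rewrite !gt_eqF ?exprn_gt0.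
  have -> : n%:R `^ (- C1) = expR (- (C1 * ln n%:R)).
    by rewrite /powR gt_eqF// mulNr.
  have -> : expR (- ((C1 + 7) * ln n%:R)) =
      expR (- (C1 * ln n%:R)) * (n%:R ^+ 7)^-1 :> R.
    by rewrite mulrDl opprD expRD [X in _ * X]expRN expRM_natl lnK.
  rewrite mulrCA -[leRHS]mulr1 ler_pM2l ?expR_gt0//.
  rewrite ler_pdivrMr ?exprn_gt0// mul1r -natrX ler_nat.
  have nn : (24 <= n * n)%N by apply: leq_trans (leq_mul n5 n5).
  have nn1 : (1 <= n * n)%N by apply: leq_trans nn.
  have h1 : ((2 * n * n).+1 <= 3 * (n * n))%N.
    by rewrite -mulnA -[3%N]/(1 + 2)%N mulnDl mul1n -add1n leq_add2r.
  have h2 : ((n * n).+1 <= 2 * (n * n))%N.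
    by rewrite -[2%N]/(1 + 1)%N mulnDl mul1n -add1n leq_add2r.
  apply: leq_trans (_ : n * (3 * (n * n)) * (2 * (n * n)) * 4 <= _)%N.
    by rewrite leq_mul2r /=; apply: leq_mul => //; rewrite leq_mul2l h1 orbT.
  have -> : (n * (3 * (n * n)) * (2 * (n * n)) * 4 = 24 * n ^ 5)%N by ring.
  have -> : (n ^ 7 = (n * n) * n ^ 5)%N by ring.
  by rewrite leq_mul2r nn orbT.
exists A; split => // w /AE [S cS MS] l hl i.
rewrite MS -/(wigner S) in hl *.
have [u [Au u1]] := unit_eigenvector_exists _ _ _ _ i (wigner_sym S) hl.
exists u; split => // j.
apply: (concentrated_delocalized n eta0 S (fun j => u j 0) (l i)) => //.
  by move=> k; have /matrixP/(_ k 0) := Au; rewrite !mxE.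
move: u1; rewrite /norm2 => /(congr1 (fun y => y ^+ 2)).
by rewrite expr1n sqr_sqrtr// sumr_ge0// => k _; exact: sqr_ge0.
Qed.

Lemma scale_factor_gt0 (R : realType) (C1 : R) : 0 < C1 -> 0 < scale_factor R C1.
Proof.
move=> C10; have a0 : 0 < noise_level :> R by rewrite /noise_level; clear; lra.
apply: divr_gt0; last exact: exprn_gt0.
by apply: mulr_gt0; [exact: ltr0n | clear -C10; lra].
Qed.

(** The only growth fact is log n = o(n), in the form log n <= 2 sqrt n. *)
Lemma eventually_admissible (R : realType) (K : R) : 0 < K ->
  \forall n \near \oo,
    [/\ (5 <= n)%N, 1 <= ln n%:R :> R, 4000 <= K * ln n%:R,
        K * ln n%:R / n%:R <= 1 & (Num.sqrt n%:R)^-1 <= 1 / 4000 :> R].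
Proof.
move=> K0; near=> n.
have n5 : (5 <= n)%N by near: n; exact: nbhs_infty_ge.
have n0R : 0 < n%:R :> R by rewrite ltr0n; apply: leq_trans n5.
have ln_ge (a : R) : expR a <= n%:R -> a <= ln n%:R.
  by move=> h; rewrite -(expRK a) ler_ln ?posrE ?expR_gt0.
have sqrt_ge (a : R) : 0 <= a -> a ^+ 2 <= n%:R -> a <= Num.sqrt n%:R.
  by move=> a0 h; rewrite -(ger0_norm a0) -sqrtr_sqr ler_wsqrtr.
have s0 : 0 < Num.sqrt n%:R :> R by rewrite sqrtr_gt0.
split => //.
- by apply: ln_ge; near: n; exact: nbhs_infty_ger.
- rewrite mulrC -ler_pdivrMr//.
  by apply: ln_ge; near: n; exact: nbhs_infty_ger.
- rewrite ler_pdivrMr// mul1r.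
  have lnE : ln n%:R = ln (Num.sqrt n%:R) + ln (Num.sqrt n%:R) :> R.
    by rewrite -lnM ?posrE// -expr2 sqr_sqrtr// ltW.
  have h1 : ln (Num.sqrt n%:R) < Num.sqrt n%:R :> R by exact: ln_sublinear.
  have h2 : 2 * K <= Num.sqrt n%:R.
    apply: sqrt_ge; first by apply: mulr_ge0 => //; exact: ltW.
    by near: n; exact: nbhs_infty_ger.
  apply: le_trans (_ : K * (2 * Num.sqrt n%:R) <= _).
    rewrite ler_pM2l// lnE; clear -h1; lra.
  rewrite mulrA (mulrC K) -[leRHS](sqr_sqrtr (ltW n0R)) expr2.
  by apply: ler_wpM2r => //; exact: ltW.
- rewrite -[leLHS]mul1r ler_pdivrMr// mulrAC mul1r ler_pdivlMr ?ltr0n// mul1r.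
  apply: sqrt_ge; first exact: ler0n.
  by near: n; exact: nbhs_infty_ger.
Unshelve. all: by end_near. Qed.

Lemma mx_norm_le_sqr (R : realType) n (u : 'cV[R]_n) (c : R) :
  (forall j, u j 0 ^+ 2 <= c) -> `|u| <= Num.sqrt c.
Proof.
move=> uc; rewrite [leLHS]/Num.Def.normr/= mx_normrE.
apply: bigmax_le; first exact: sqrtr_ge0.
move=> -[j k] _ /=; rewrite (ord1 k) -sqrtr_sqr; exact: ler_wsqrtr.
Qed.

(* `|u| is the norm of the library on matrices, i.e. the maximum modulus of the
   entries of u. *)
Theorem theorem1p7 (R : realType)
  (d : nat -> measure_display)
  (T : forall n : nat, measurableType (d n))
  (P : forall n : nat, probability (T n) R)
  (x : forall n : nat, 'I_n -> 'I_n -> {RV (P n) >-> R})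
  (W : forall n : nat, T n -> 'M[R]_n)
  (lambda : forall n : nat, T n -> 'I_n -> R)
  (hx : forall n : nat, symmetric_rademacher (x n))
  (hW : forall (n : nat) (w : T n), W n w = normalized (random_matrix (x n) w))
  (hlambda : forall (n : nat) (w : T n), eigenvalue_list (W n w) (lambda n w)) :
  forall C1 : R, 0 < C1 ->
  exists C2 : R, 0 < C2 /\
    (* bulk *)
    (forall eps : R, 0 < eps ->
      \forall n \near \oo,
        with_probability_at_least (P n) (1 - n%:R `^ (- C1))
          [set w : T n | forall i : 'I_n,
             lambda n w i \in `[-2 + eps, 2 - eps] ->
             exists u : 'cV[R]_n,
               unit_eigenvector (W n w) (lambda n w i) u /\
               `|u| <= C2 * Num.sqrt (ln n%:R) / Num.sqrt n%:R]) /\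
    (* edge *)
    (\forall n \near \oo,
        with_probability_at_least (P n) (1 - n%:R `^ (- C1))
          [set w : T n | forall eps : R, 0 < eps -> forall i : 'I_n,
             (lambda n w i \in `[-2 - eps, -2 + eps]) \/
             (lambda n w i \in `[2 - eps, 2 + eps]) ->
             exists u : 'cV[R]_n,
               unit_eigenvector (W n w) (lambda n w i) u /\
               `|u| <= C2 * ln n%:R / Num.sqrt n%:R]).
Proof.
move=> C1 C10; pose K := scale_factor R C1.
have K0 : 0 < K := scale_factor_gt0 _ _ C10.
pose C2 := Num.sqrt (42 / 10 * K).
have C20 : 0 < C2 by rewrite sqrtr_gt0; clear -K0; lra.
have delocalized : \forall n \near \oo,
    1 <= ln n%:R :> R /\
    with_probability_at_least (P n) (1 - n%:R `^ (- C1))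
      [set w : T n | forall i, exists u : 'cV[R]_n,
         unit_eigenvector (W n w) (lambda n w i) u /\
         `|u| <= C2 * Num.sqrt (ln n%:R) / Num.sqrt n%:R].
  apply: filterS (eventually_admissible _ _ K0) => n [n5 ln1 Kln Kn nsqrt].
  have n0R : 0 < n%:R :> R by rewrite ltr0n; apply: leq_trans n5.
  split => //.
  have nE : n%:R * (K * ln n%:R / n%:R) = K * ln n%:R.
    by rewrite mulrC mulfVK ?gt_eqF.
  have [||A [mA AE PA]] := wigner_delocalization _ _ _ _ n _ C1 (hx n) C10 n5 _ Kn _ nsqrt.
  - by rewrite divr_gt0// mulr_gt0//; apply: lt_le_trans ln1.
  - by rewrite -/K nE.
  exists A; split => // w /AE Aw i.
  have := hlambda n w; rewrite hW => /Aw /(_ i)[u [uE ub]].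
  exists u; split => //.
  apply: le_trans (mx_norm_le_sqr _ _ _ _ ub) _.
  have l0 : 0 <= ln n%:R :> R by apply: le_trans ln1.
  have -> : 42 / 10 * (scale_factor R C1 * ln n%:R / n%:R) =
      (42 / 10 * K) * (ln n%:R * n%:R^-1) by rewrite /K; ring.
  rewrite sqrtrM; last by clear -K0; lra.
  by rewrite (sqrtrM _ l0) sqrtrV ?(ltW n0R)// mulrA.
exists C2; split => //; split.
- move=> eps _; apply: filterS delocalized => n [_ [A [mA AE PA]]].
  by exists A; split => // w /AE + i _; apply.
- apply: filterS delocalized => n [ln1 [A [mA AE PA]]].
  (* For large n, sqrt (log n) <= log n. *)
  exists A; split => // w /AE Aw eps _ i _; have [u [uE ub]] := Aw i.
  exists u; split => //; apply: le_trans ub _.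
  apply: ler_wpM2r; first by rewrite invr_ge0 sqrtr_ge0.
  apply: ler_wpM2l; first exact: ltW.
  rewrite -[leLHS]mulr1 -[leRHS](sqr_sqrtr (le_trans ler01 ln1)) expr2.
  apply: ler_wpM2l; first exact: sqrtr_ge0.
  by rewrite -[leLHS]sqrtr1; apply: ler_wsqrtr.
Qed.
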